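(* Let $(X,T)$ be a dynamical system with the shadowing property and let $\Phi:X\to\mathbb{R}$ be a continuous function. Then $$h_{\mathrm{top}}(T,I_\Phi(T))=\sup\{h_{\mathrm{top}}(T,Y): Y\in C_c(X,T)\text{ and } I_\Phi(T)\cap Y^\omega\neq\emptyset\}.$$
   Context: A dynamical system $(X,T)$ is a compact metric space $(X,d)$ together with a continuous map $T:X\to X$. For $\delta>0$, a sequence $\{x_n\}_{n\ge 0}\subseteq X$ is a $\delta$-pseudo-orbit if $d(Tx_n,x_{n+1})<\delta$ for all $n\geq 0$; a finite one $\{x_i\}_{i=0}^k$, with $k\ge1$, is a $\delta$-chain from $x_0$ to $x_k$. $(X,T)$ has the shadowing property if for every $\varepsilon>0$ there is $\delta>0$ such that for every $\delta$-pseudo-orbit $\{x_n\}_{n\ge 0}$ there is $y\in X$ with $d(T^ny,x_n)<\varepsilon$ for all $n\geq 0$. Points $x,y\in X$ are chain related if for every $\varepsilon>0$ there are an $\varepsilon$-chain from $x$ to $y$ and an $\varepsilon$-chain from $y$ to $x$. A point is chain recurrent if it is chain related to itself. Chain relatedness is an equivalence relation on the set $CR(X)$ of chain recurrent points, and its equivalence classes are the chain recurrent classes; each is closed and satisfies $T(Y)\subseteq Y$. $C_c(X,T)$ denotes the set of all chain recurrent classes of $(X,T)$. For $x\in X$, $\omega_T(x)=\bigcap_{n\ge0}\overline{\{T^k(x):k\geq n\}}$ is the $\omega$-limit set, and for $Y\subseteq X$, $Y^\omega=\{x\in X:\omega_T(x)\subseteq Y\}$. The $\Phi$-irregular set $I_\Phi(T)$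 is the set of $x\in X$ for which $\lim_{n\to\infty}\frac1n\sum_{i=0}^{n-1}\Phi(T^ix)$ does not exist. $h_{\mathrm{top}}(T,E)$ is the Bowen topological entropy of a (not necessarily compact or invariant) set $E\subseteq X$: let $B_n(x,\varepsilon)=\{y\in X:\max_{0\le j\le n-1}d(T^jx,T^jy)<\varepsilon\}$; let $\mathcal{G}_n(E,\varepsilon)$ be the collection of all finite or countable coverings of $E$ by balls $B_v(x,\varepsilon)$ with $v\geq n$; put $C(E;t,n,\varepsilon,T)=\inf_{C\in\mathcal{G}_n(E,\varepsilon)}\sum_{B_v(x,\varepsilon)\in C}e^{-tv}$, $C(E;t,\varepsilon,T)=\lim_{n\to\infty}C(E;t,n,\varepsilon,T)$, $h_{\mathrm{top}}(E,\varepsilon,T)=\inf\{t:C(E;t,\varepsilon,T)=0\}$ and $h_{\mathrm{top}}(T,E)=\lim_{\varepsilon\to0}h_{\mathrm{top}}(E,\varepsilon,T)$. Conventions for the degenerate case: $h_{\mathrm{top}}(T,\emptyset)=0$ and the supremum of the empty set is $0$. *)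

(* Defs.v *)
From mathcomp Require Import all_boot all_order all_algebra.
From mathcomp Require Import all_classical all_reals all_analysis.

Set Implicit Arguments.
Unset Strict Implicit.
Unset Printing Implicit Defensive.

Import Order.TTheory GRing.Theory Num.Theory.
Import numFieldNormedType.Exports.

Local Open Scope classical_set_scope.
Local Open Scope ring_scope.

Section Dynamics.
Context {R : realType} {X : metricType R}.
Implicit Types (T : X -> X) (E Y : set X) (x y : X) (u : nat -> X).

Definition dynamical_system T : Prop := compact [set: X] /\ continuous T.

Definition pseudo_orbit T (delta : R) u : Prop :=
  forall n, mdist (T (u n)) (u n.+1) < delta.

(* Only the terms of index at most [k] of the sequence are constrained. *)
Definition is_chain T (delta : R) (k : nat) u x y : Prop :=
  [/\ (1 <= k)%N, u 0%N = x, u k = y &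
      forall i, (i < k)%N -> mdist (T (u i)) (u i.+1) < delta].

Definition has_chain T (delta : R) x y : Prop :=
  exists (k : nat) u, is_chain T delta k u x y.

Definition shadowing_property T : Prop :=
  forall eps : R, 0 < eps -> exists2 delta : R, 0 < delta &
    forall u, pseudo_orbit T delta u ->
      exists y, forall n, mdist (iter n T y) (u n) < eps.

Definition chain_related T x y : Prop :=
  forall eps : R, 0 < eps -> has_chain T eps x y /\ has_chain T eps y x.

Definition chain_recurrent T x : Prop := chain_related T x x.

Definition CR T : set X := [set x | chain_recurrent T x].

Definition chain_recurrent_classes T : set (set X) :=
  [set Y | exists2 x, CR T x & Y = [set y | CR T y /\ chain_related T x y]].

Definition omega_limit T x : set X :=
  \bigcap_n closure [set iter k T x | k in [set k | (n <= k)%N]].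

Definition omega_basin T Y : set X := [set x | omega_limit T x `<=` Y].

Definition birkhoff_average T (Phi : X -> R) (x : X) (n : nat) : R :=
  n%:R^-1 * \sum_(i < n) Phi (iter i T x).

(* [cvgn] in [R] means convergence to a finite real number. *)
Definition irregular_set T (Phi : X -> R) : set X :=
  [set x | ~ cvgn (birkhoff_average T Phi x)].

Definition bowen_ball T (n : nat) (x : X) (eps : R) : set X :=
  [set y | forall j, (j < n)%N -> mdist (iter j T x) (iter j T y) < eps].

(* A family of balls is represented by the set of its labels: the pair [(v, x)]
   stands for the ball [bowen_ball T v x eps]. *)
Definition bowen_covers T E (n : nat) (eps : R) : set (set (nat * X)) :=
  [set C | [/\ countable C, (forall p, C p -> (n <= p.1)%N) &
               E `<=` \bigcup_(p in C) bowen_ball T p.1 p.2 eps]].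

Definition bowen_cost T E (t : R) (n : nat) (eps : R) : \bar R :=
  ereal_inf [set (\esum_(p in C) (expR (- (t * p.1%:R)))%:E)%E
            | C in bowen_covers T E n eps].

Definition bowen_outer T E (t eps : R) : \bar R :=
  limn (fun n => bowen_cost T E t n eps).

Definition htop_scale T E (eps : R) : \bar R :=
  ereal_inf [set t%:E | t in [set t : R | bowen_outer T E t eps = 0%E]].

(* The critical exponent [htop_scale T set0 eps] is [-oo], as [t] ranges over
   all reals; hence the separate convention for the empty set. *)
Definition htop T E : \bar R :=
  if E == set0 then 0%E else lim (htop_scale T E eps @[eps --> 0^'+]).

End Dynamics.

(* Supremum with value 0 (and not [-oo]) on the empty set. *)
Definition sup_or0 {R : realType} (A : set (\bar R)) : \bar R :=
  if A == set0 then 0%E else ereal_sup A.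

(* Main.v *)
Require Import Defs.
From mathcomp Require Import all_boot all_order all_algebra.
From mathcomp Require Import all_classical all_reals all_analysis.
From mathcomp Require Import ring lra zify.

(**
Upper bound. The omega-limit set of any point lies in one chain recurrent class,
so every irregular point is in the basin of a class that is counted in the
supremum. It remains to see that a set [E] has entropy at most [s] when the
omega-limit sets of its points do ([htop_le_omega_limits]). For [t > s], such an
omega-limit set has a finite cover by Bowen balls whose weights [e ^ (- t * v)]
add up to less than 1. The orbit eventually stays in the union of these balls, so
it is a concatenation of pieces that follow them; covers by words of [r] pieces
have a total weight that decays geometrically in [r]. With centres in finite
nets there are only countably many finite covers, and null sets are countably
stable, so the possibly uncountable number of classes does no harm.

Lower bound. Let [x] be irregular, [p] a point of its omega-limit set and [Y] the
class of [p]. If [s] is less than the entropy of [Y], then at some scale [Y] has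
at least [c * e ^ (s * n)] points that are separated up to time [n], for all
large [n] ([many_separated]). The orbit of [x] approaches [Y] and its Birkhoff
averages oscillate; cutting it at suitable times yields, for every tolerance,
two closed pseudo-orbits at a point of [Y] that have the same length and whose
averages differ by a fixed gap ([two_loops]). Blocks are formed from a
separated orbit segment and a small proportion of one of these two loops, joined
by chains of bounded length. Any sequence of segments can be combined with any
sequence of loops, and shadowing traces the resulting pseudo-orbit.

Nothing is known about the averages along the segments, but this does not
matter. For a fixed sequence of segments, compare two sequences of loops: the
constant one, and one in which the frequency of the second loop has no limit.
The difference of the two Birkhoff averages diverges, so one of the two traced
points is irregular ([htop_irregular_ge_blocks]). Thus every sequence of
segments codes an irregular point, and points with different codes are
separated when the codes first differ. A cover of the coded points by Bowen
balls then induces a cover of the full shift by cylinders, whose total mass is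
at least 1 ([coded_cost_ge]); this bounds the entropy of the irregular set from
below by the rate at which blocks are distinguished, which is as close to [s]
as desired.
*)

Set Implicit Arguments.
Unset Strict Implicit.
Unset Printing Implicit Defensive.

Import Order.TTheory GRing.Theory Num.Theory.
Import numFieldNormedType.Exports.

Local Open Scope classical_set_scope.
Local Open Scope ring_scope.

(** * Compactness in metric spaces *)

Section CompactMetric.
Context {R : realType} {X : metricType R}.
Implicit Types (x y z : X) (A U : set X).

Lemma nbhs_mdist x U :
  nbhs x U <-> exists2 e : R, 0 < e & forall y, mdist x y < e -> U y.
Proof.
split=> [/nbhs_ballP[e e0 sU]|[e e0 sU]].
  by exists e => // y xy; apply: sU; rewrite ballEmdist.
by apply/nbhs_ballP; exists e => // y; rewrite ballEmdist; exact: sU.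
Qed.

Lemma near_mdist_continuous (T : X -> X) x (e : R) : continuous T -> 0 < e ->
  \forall y \near x, mdist (T x) (T y) < e.
Proof.
move=> cT e0; have : nbhs (T x) [set z | mdist (T x) z < e].
  by apply/nbhs_mdist; exists e.
exact: cT.
Qed.

Lemma mdist_trans_lt x y z (a b : R) :
  mdist x y < a -> mdist y z < b -> mdist x z < a + b.
Proof. by move=> xy yz; rewrite (le_lt_trans (metric_triangle x y z)) ?ltrD. Qed.

Lemma mdist_trans_sym x y z (a b : R) :
  mdist y x < a -> mdist y z < b -> mdist x z < a + b.
Proof. by rewrite metric_sym; exact: mdist_trans_lt. Qed.

(** The near-covering form of compactness is applied to the filter of all
    sufficiently large finite subfamilies. This avoids a chosen point of the
    space and asks for neighbourhoods instead of open sets, which is what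
    Bowen balls provide. *)
Lemma compact_finite_subcover (I : eqType) (D : set I) (U : I -> set X) A :
  compact A -> (forall x, A x -> exists2 i, D i & nbhs x (U i)) ->
  exists2 s : seq I, {in s, forall i, D i} &
    forall x, A x -> exists2 i, i \in s & U i x.
Proof.
move=> /compact_near_coveringP cA AU.
pose B (s0 : seq I) := [set s : seq I | {subset s0 <= s} /\ {in s, forall i, D i}].
pose F := filter_from [set s0 : seq I | {in s0, forall i, D i}] B.
have FF : Filter F.
  apply: filter_from_filter; first by exists [::].
  move=> s1 s2 /= D1 D2; exists (s1 ++ s2).
    by move=> i /=; rewrite mem_cat => /orP[/D1|/D2].
  move=> s [ss Ds]; split; split => // i i12; apply: ss;
    by rewrite mem_cat i12 ?orbT.
have [x Ax|s0 Ds0 /(_ s0)] := cA _ F (fun s x => exists2 i, i \in s & U i x) FF.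
  have [i Di Ui] := AU x Ax.
  exists (U i, B [:: i]); first split => //=.
    by exists [:: i] => // j; rewrite inE => /eqP ->.
  by move=> [z s] /= [Uz [/(_ i) is_ _]]; exists i => //; apply: is_; rewrite inE.
by move=> H; exists s0 => //; apply: H; split.
Qed.

(** The cluster point is reached along any prescribed infinite set of times. *)
Lemma compact_cluster_seq (u : nat -> X) (S : nat -> Prop) :
  compact [set: X] -> (forall n, exists2 k, (n <= k)%N & S k) ->
  exists y, forall (e : R) n, 0 < e ->
    exists k, [/\ (n <= k)%N, S k & mdist y (u k) < e].
Proof.
move=> /compact_near_coveringP cX Sinf; apply: contrapT => noy.
have : \forall n \near \oo, [set: X] `<=` (fun x => forall k, (n <= k)%N -> S k -> u k <> x).
  apply: cX => y _; have := noy; rewrite -forallNE => /(_ y).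
  move=> /existsNP[e] /existsNP[n] /not_implyP[e0 /forallNP nk].
  exists ([set x | mdist y x < e], [set m | (n <= m)%N]); first split => /=.
  - by apply/nbhs_mdist; exists e.
  - by exists n.
  move=> [x m] /= [xy nm] k mk Sk ukx; apply: (nk k); split => //.
    exact: leq_trans mk.
  by rewrite ukx.
case=> n _ /(_ n (leqnn n)) /= H; have [k nk Sk] := Sinf n.
exact: (H (u k) I k nk Sk erefl).
Qed.

Lemma compact_uniformly_continuous (f : X -> R) : compact [set: X] -> continuous f ->
  forall e : R, 0 < e ->
  exists2 d : R, 0 < d & forall x y, mdist x y < d -> `|f x - f y| < e.
Proof.
move=> /compact_near_coveringP cX cf e e0.
have e20 : 0 < e / 2 by lra.
have [|d /= d0 H] := cX _ (0 : R)^'+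
  (fun d x => forall y, mdist x y < d -> `|f x - f y| < e) _.
  move=> x _; have /cvgrPdist_lt/(_ _ e20)/nbhs_mdist[r r0 rf] := cf x.
  exists ([set z | mdist x z < r / 2], [set d | d < r / 2]); first split => /=.
  - by apply/nbhs_mdist; exists (r / 2) => //; lra.
  - by apply: nbhs_right_lt; lra.
  move=> [z d] /= [xz dr] y zy.
  have /rf fy : mdist x y < r.
    by rewrite (splitr r); apply: mdist_trans_lt xz _; exact: lt_trans dr.
  have /rf fz : mdist x z < r by lra.
  rewrite (splitr e); apply: le_lt_trans (ltrD fz fy).
  by rewrite (distrC (f x) (f z)); exact: ler_distD.
exists (d / 2); first by lra.
move=> x y xy; apply: (H (d / 2)) => //=; last by lra.
by rewrite sub0r normrN gtr0_norm; lra.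
Qed.

Lemma compact_norm_le (f : X -> R) : compact [set: X] -> continuous f ->
  exists2 M : R, 0 < M & forall x, `|f x| <= M.
Proof.
move=> /compact_near_coveringP cX cf.
have [|M [_ /(_ (Num.max M 0 + 1)) H]] := cX _ (pinfty_nbhs R) (fun M x => `|f x| <= M) _.
  move=> x _; have /cvgrPdist_lt/(_ _ ltr01) fx := cf x.
  exists ([set z | `|f x - f z| < 1], [set d | `|f x| + 1 < d]); first split => //=.
    by exists (`|f x| + 1); split => //; rewrite num_real.
  move=> [z d] /= [xz dr].
  apply: ltW; apply: le_lt_trans dr.
  have -> : f z = f x - (f x - f z) by lra.
  by rewrite (le_trans (ler_normB _ _))// lerD2l ltW.
exists (Num.max M 0 + 1); first by rewrite ltr_wpDl// le_max lexx orbT.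
by move=> x; apply: H => //; rewrite ltr_pwDr// le_max lexx.
Qed.

End CompactMetric.

(** * Bowen covers and entropy *)

Section BowenEntropy.
Context {R : realType} {X : metricType R}.
Variable T : X -> X.
Implicit Types (E : set X) (t s eps : R) (n : nat).
Local Open Scope ereal_scope.

Lemma bowen_ball_le n x eps1 eps2 : (eps1 <= eps2)%R ->
  bowen_ball T n x eps1 `<=` bowen_ball T n x eps2.
Proof. by move=> e12 y xy j jn; apply: lt_le_trans e12; exact: xy. Qed.

Lemma bowen_cost_ge0 E t n eps : 0 <= bowen_cost T E t n eps.
Proof.
apply: le_ereal_inf_tmp => _ [C _ <-]; apply: esum_ge0 => p _.
by rewrite lee_fin expR_ge0.
Qed.

Lemma bowen_cost_le E t n eps C : bowen_covers T E n eps C ->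
  bowen_cost T E t n eps <= \esum_(p in C) (expR (- (t * p.1%:R)))%:E.
Proof. by move=> CE; apply: ereal_inf_lbound; exists C. Qed.

Lemma bowen_cost_homo_n E t eps m n : (m <= n)%N ->
  bowen_cost T E t m eps <= bowen_cost T E t n eps.
Proof.
move=> mn; apply: le_ereal_inf_tmp => _ [C [cC nC EC] <-].
by apply: bowen_cost_le; split => // p /nC; exact: leq_trans.
Qed.

Lemma bowen_cost_homo_t E t1 t2 eps n : (t1 <= t2)%R ->
  bowen_cost T E t2 n eps <= bowen_cost T E t1 n eps.
Proof.
move=> t12; apply: le_ereal_inf_tmp => _ [C CE <-].
apply: le_trans (bowen_cost_le t2 CE) _; apply: le_esum => p _.
by rewrite lee_fin ler_expR lerN2 ler_wpM2r.
Qed.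

Lemma bowen_cost_homo_eps E t eps1 eps2 n : (eps1 <= eps2)%R ->
  bowen_cost T E t n eps2 <= bowen_cost T E t n eps1.
Proof.
move=> e12; apply: le_ereal_inf_tmp => _ [C [cC nC EC] <-].
apply: bowen_cost_le; split => // x /EC[p Cp xp]; exists p => //.
exact: bowen_ball_le xp.
Qed.

Lemma bowen_cost_homo_set E F t eps n : E `<=` F ->
  bowen_cost T E t n eps <= bowen_cost T F t n eps.
Proof.
move=> EF; apply: le_ereal_inf_tmp => _ [C [cC nC FC] <-].
by apply: bowen_cost_le; split => //; exact: subset_trans FC.
Qed.

(** The costs increase with the minimal length [n], so their limit is their
    supremum. Critical exponents can then be discussed one length at a time. *)
Lemma bowen_outer_eq0 E t eps :
  bowen_outer T E t eps = 0 <-> forall n, bowen_cost T E t n eps = 0.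
Proof.
have outerE : bowen_outer T E t eps = ereal_sup (range (fun n => bowen_cost T E t n eps)).
  apply/cvg_lim => //; apply: ereal_nondecreasing_cvgn => m n.
  exact: bowen_cost_homo_n.
rewrite outerE; split => [s0 n|c0].
  apply/eqP; rewrite eq_le bowen_cost_ge0 andbT -s0.
  by apply: ereal_sup_ubound; exists n.
apply/eqP; rewrite eq_le; apply/andP; split.
  by apply: ge_ereal_sup => _ [n _ <-]; rewrite c0.
by apply: ereal_sup_ubound; exists 0%N.
Qed.

Lemma htop_scale_homo E eps1 eps2 : (eps1 <= eps2)%R ->
  htop_scale T E eps2 <= htop_scale T E eps1.
Proof.
move=> e12; apply: ereal_inf_le_tmp => _ [t /bowen_outer_eq0 t0 <-].
exists t => //; apply/bowen_outer_eq0 => n; apply/eqP.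
by rewrite eq_le bowen_cost_ge0 andbT -(t0 n) bowen_cost_homo_eps.
Qed.

(** Smaller balls make covering more expensive, hence the limit as the scale
    tends to 0 from the right is a supremum over all scales. *)
Lemma htopE E : E !=set0 ->
  htop T E = ereal_sup [set htop_scale T E eps | eps in [set eps | (0 < eps)%R]].
Proof.
move=> /set0P/negPf E0; rewrite /htop E0; apply/cvg_lim => //.
have -> : [set eps : R | (0 < eps)%R] = [set` `]0%R, +oo[].
  by apply/seteqP; split=> x /=; rewrite in_itv/= andbT.
apply: (@nonincreasing_at_right_cvge _ (htop_scale T E) 0%R +oo%O) => //.
by move=> x y _ _; exact: htop_scale_homo.
Qed.

Lemma bowen_cost_lt_htop E t eps n : E !=set0 -> (0 < eps)%R ->
  htop T E < t%:E -> bowen_cost T E t n eps = 0.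
Proof.
move=> E0 eps0; rewrite htopE// => ht.
have /ereal_inf_lt[_ [s s0 <-] st] : htop_scale T E eps < t%:E.
  by apply: le_lt_trans ht; apply: ereal_sup_ubound; exists eps.
move/bowen_outer_eq0 : s0 => /(_ n) s0; apply/eqP.
rewrite eq_le bowen_cost_ge0 andbT -s0; apply: bowen_cost_homo_t.
by rewrite ltW// -lte_fin.
Qed.

Lemma htop_le E s : E !=set0 ->
  (forall t eps n, (s < t)%R -> (0 < eps)%R -> bowen_cost T E t n eps = 0) ->
  htop T E <= s%:E.
Proof.
move=> E0 H; rewrite htopE//; apply: ge_ereal_sup => _ [eps eps0 <-].
apply/lee_addgt0Pr => e e0; apply: ereal_inf_lbound.
exists (s + e)%R => //; apply/bowen_outer_eq0 => n; apply: H => //.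
by rewrite ltrDl.
Qed.

Lemma htop_ge E s eps : E !=set0 -> (0 < eps)%R ->
  (forall t, (t < s)%R -> exists n, bowen_cost T E t n eps != 0) ->
  s%:E <= htop T E.
Proof.
move=> E0 eps0 H; rewrite htopE//.
apply: (@le_trans _ _ (htop_scale T E eps)); last first.
  by apply: ereal_sup_ubound; exists eps.
apply: le_ereal_inf_tmp => _ [t /bowen_outer_eq0 t0 <-]; rewrite lee_fin leNgt.
by apply/negP => /H[n]; rewrite t0 eqxx.
Qed.

Lemma htop_gt E s : E !=set0 -> s%:E < htop T E ->
  exists eps n, (0 < eps)%R /\ 0 < bowen_cost T E s n eps.
Proof.
move=> E0; rewrite htopE// => /ereal_sup_gt[_ [eps eps0 <-] seps].
have [n sn] : exists n, bowen_cost T E s n eps != 0.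
  apply: contrapT => /forallNP no; move: seps; rewrite ltNge => /negP; apply.
  apply: ereal_inf_lbound; exists s => //; apply/bowen_outer_eq0 => n.
  by have /negP/negPn/eqP := no n.
by exists eps, n; split => //; rewrite lt_def sn bowen_cost_ge0.
Qed.

(** At a negative exponent every single ball of a cover costs at least 1. *)
Lemma htop_ge0 E : E !=set0 -> 0 <= htop T E.
Proof.
move=> E0; apply: (@htop_ge _ 0%R 1%R) => // t t0; exists 0%N.
apply/eqP => c0; have : 1 <= bowen_cost T E t 0 1.
  apply: le_ereal_inf_tmp => _ [C [_ _ EC] <-].
  have [x /EC[p Cp _]] := E0.
  apply: (@le_trans _ _ (expR (- (t * p.1%:R)))%:E).
    by rewrite lee_fin -expR0 ler_expR oppr_ge0 mulr_le0_ge0// ltW.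
  apply: esum_ge; exists [set p]; last by rewrite fsbig_set1.
  by split => // q ->.
by rewrite c0 lee_fin ler10.
Qed.

Lemma htop_homo E F : E !=set0 -> E `<=` F -> htop T E <= htop T F.
Proof.
move=> E0 EF; have F0 : F !=set0 by case: E0 => x /EF; exists x.
rewrite !htopE//; apply: ge_ereal_sup => _ [eps eps0 <-].
apply: (@le_trans _ _ (htop_scale T F eps)); last by apply: ereal_sup_ubound; exists eps.
apply: ereal_inf_le_tmp => _ [t /bowen_outer_eq0 t0 <-]; exists t => //.
apply/bowen_outer_eq0 => n; apply/eqP.
by rewrite eq_le bowen_cost_ge0 andbT -(t0 n) bowen_cost_homo_set.
Qed.

End BowenEntropy.

(** * Covers from families of balls *)

Section CoverFamilies.
Context {R : realType}.

Lemma esum_subset (I : choiceType) (J K : set I) (a : I -> \bar R) :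
  J `<=` K -> (\esum_(j in J) a j <= \esum_(j in K) a j)%E.
Proof.
move=> JK; apply: ge_ereal_sup => _ [F [finF FJ] <-].
by apply: esum_ge; exists F => //; split => // x /FJ/JK.
Qed.

(** A family of balls may list the same label several times, whereas a cover
    is a set of labels. The set costs no more than the family. *)
Lemma esum_image_le (I K : choiceType) (J : set I) (f : I -> K)
    (a : K -> \bar R) :
  (\esum_(p in f @` J) a p <= \esum_(j in J) a (f j))%E.
Proof.
have [->|/set0P[j0 Jj0]] := eqVneq J set0; first by rewrite image_set0 !esum_set0.
pose g p := if pselect (exists2 j, J j & f j = p) is left h
            then projT1 (cid2 h) else j0.
have gP p : (f @` J) p -> J (g p) /\ f (g p) = p.
  move=> Jp; rewrite /g; case: pselect => [h|]; last by [].
  by case: cid2.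
have ginj : set_inj (f @` J) g.
  by move=> p q /set_mem/gP[_ fp] /set_mem/gP[_ fq] gpq; rewrite -fp -fq gpq.
have -> : (\esum_(p in f @` J) a p = \esum_(j in g @` (f @` J)) a (f j))%E.
  by rewrite [RHS]esum_image//; apply: eq_esum => p Jp; rewrite (gP p Jp).2.
by apply: esum_subset => _ [p /gP[Jp _] <-].
Qed.

Lemma sum_undup_le (I : eqType) (s : seq I) (a : I -> R) :
  (forall i, 0 <= a i) -> \sum_(i <- undup s) a i <= \sum_(i <- s) a i.
Proof.
move=> a0; elim: s => [|x s IH] /=; first by rewrite big_nil.
case: ifP => _; rewrite !big_cons; last by rewrite lerD2l.
by apply: le_trans IH _; rewrite lerDr.
Qed.

Context {X : metricType R} (T : X -> X).
Implicit Types (E : set X) (t eps : R) (n : nat).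

Lemma bowen_cost_seq E t n eps (s : seq (nat * X)) :
  {in s, forall p, (n <= p.1)%N} ->
  (forall x, E x -> exists2 p, p \in s & bowen_ball T p.1 p.2 eps x) ->
  (bowen_cost T E t n eps <= (\sum_(p <- s) expR (- (t * p.1%:R)))%:E)%E.
Proof.
move=> sn Es.
have CE : bowen_covers T E n eps [set` undup s].
  split; first by apply: finite_set_countable; exact: finite_seq.
    by move=> p /=; rewrite mem_undup => /sn.
  by move=> x /Es[p ps xp]; exists p => //=; rewrite mem_undup.
apply: le_trans (bowen_cost_le t CE) _.
rewrite esum_fset; [|exact: finite_seq|by move=> p _; rewrite lee_fin expR_ge0].
rewrite -fsbig_seq ?undup_uniq// sumEFin lee_fin.
by apply: sum_undup_le => p; exact: expR_ge0.
Qed.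

Lemma bowen_cost_set0 t n eps : bowen_cost T set0 t n eps = 0%E.
Proof.
apply/eqP; rewrite eq_le bowen_cost_ge0 andbT.
by apply: le_trans (@bowen_cost_seq set0 t n eps [::] _ _) _; rewrite ?big_nil.
Qed.

(** Countable stability of the null sets: it reduces the upper bound to the
    countably many sets of points with a common eventual itinerary. *)
Lemma bowen_cost_bigcup (E : nat -> set X) t n eps :
  (forall i, bowen_cost T (E i) t n eps = 0)%E ->
  bowen_cost T (\bigcup_i E i) t n eps = 0%E.
Proof.
move=> E0; apply/eqP; rewrite eq_le bowen_cost_ge0 andbT.
apply/lee_addgt0Pr => e e0; rewrite add0e.
have /choice[C HC] i : exists C, bowen_covers T (E i) n eps C /\
    (\esum_(p in C) (expR (- (t * p.1%:R)))%:E <= (e / (2 ^ i.+1)%:R)%:E)%E.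
  have : (bowen_cost T (E i) t n eps < (e / (2 ^ i.+1)%:R)%:E)%E.
    by rewrite E0 lte_fin divr_gt0// ltr0n expn_gt0.
  by move=> /ereal_inf_lt[_ [C CE <-] /ltW Ce]; exists C.
pose J : set (nat * (nat * X)) := [set: nat] `*`` C.
have CE : bowen_covers T (\bigcup_i E i) n eps (snd @` J).
  split.
  - apply: sub_countable (card_image_le _ _) _; apply: countableXR => // i _.
    by have [[]] := HC i.
  - by move=> _ [[i p] /= [_ Cp] <-]; have [[_ + _] _] := HC i; exact.
  - move=> x [i _ Ex]; have [[_ _ /(_ x Ex)[p Cp xp]] _] := HC i.
    by exists p => //; exists (i, p).
apply: le_trans (bowen_cost_le t CE) _; apply: le_trans (esum_image_le _ _ _) _.
rewrite /J -(@esum_esum _ _ _ _ _ (fun _ p => (expR (- (t * p.1%:R)))%:E)); last first.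
  by move=> *; rewrite lee_fin expR_ge0.
apply: le_trans (epsilon_trick0 xpredT (ltW e0)).
rewrite nneseries_esumT; last first.
  by move=> i; rewrite lee_fin divr_ge0// ltW.
by apply: le_esum => i _; have [_] := HC i.
Qed.

End CoverFamilies.

(** * Entropy and omega-limit sets *)

Section OmegaLimitEntropy.
Context {R : realType} {X : metricType R} (T : X -> X).
Hypotheses (cX : compact [set: X]) (cT : continuous T).
Implicit Types (E : set X) (t eps : R) (n : nat).

Lemma continuous_iter j : continuous (iter j T).
Proof.
elim: j => [|j IH] x; first exact: cvg_id.
by apply: (@continuous_comp _ _ _ (iter j T) T); [exact: IH|exact: cT].
Qed.

Lemma nbhs_bowen_ball n c x eps : bowen_ball T n c eps x ->
  nbhs x (bowen_ball T n c eps).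
Proof.
elim: n => [|n IH] cx; first by apply: filterS (@filterT _ (nbhs x) _).
have near_n : \forall y \near x, mdist (iter n T c) (iter n T y) < eps.
  have e0 : 0 < eps - mdist (iter n T c) (iter n T x) by rewrite subr_gt0 cx.
  have := near_mdist_continuous x (@continuous_iter n) e0.
  apply: filterS => y xy.
  by rewrite (le_lt_trans (metric_triangle _ (iter n T x) _))// -ltrBrDl.
have near_lt : \forall y \near x, bowen_ball T n c eps y.
  by apply: IH => j jn; apply: cx; exact: ltnW.
apply: filterS2 near_lt near_n => y yn yx j.
by rewrite ltnS leq_eqVlt => /predU1P[->//|]; exact: yn.
Qed.

Lemma bowen_ball_center n x eps : 0 < eps -> bowen_ball T n x eps x.
Proof. by move=> e0 j _; rewrite mdistxx. Qed.

Lemma finite_bowen_net n eps : 0 < eps ->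
  exists s : seq X, forall x, exists2 c, c \in s & bowen_ball T n c eps x.
Proof.
move=> e0; have [|s _ Hs] := @compact_finite_subcover _ _ _ setT
  (fun c => bowen_ball T n c eps) _ cX.
  by move=> x _; exists x => //; apply/nbhs_bowen_ball/bowen_ball_center.
by exists s => x; exact: Hs.
Qed.

(** The finite list [l] stands for the union of its Bowen balls, and the set
    for the points whose orbit stays in that union from time [m] on. *)
Definition itinerary_set eps (l : seq (nat * X)) (m : nat) : set X :=
  [set z | forall k, (m <= k)%N ->
    exists2 p, p \in l & bowen_ball T p.1 p.2 eps (iter k T z)].

(** Cutting the orbit after time [m] into [r] consecutive pieces, each of which
    follows a ball of [l], gives pieces of the set that are indexed by words of
    length [r] in [l]. A word has the product of the weights of its letters, so
    the total weight is the [r]-th power of the weight of [l], up to a constant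
    that accounts for the first [m] steps. Pieces are kept as sets, bounded in
    the Bowen metric, because they are not balls; whence the doubled radius. *)
Lemma itinerary_pieces eps t (l : seq (nat * X)) m : 0 < eps ->
  {in l, forall p, (1 <= p.1)%N} ->
  exists K : R, forall r, exists s : seq (nat * set X),
    [/\ {in s, forall p, (maxn r m <= p.1)%N},
        {in s, forall p z z', p.2 z -> p.2 z' ->
           bowen_ball T p.1 z (2 * eps) z'},
        forall z, itinerary_set eps l m z -> exists2 p, p \in s & p.2 z &
        \sum_(p <- s) expR (- (t * p.1%:R)) <=
          K * (\sum_(p <- l) expR (- (t * p.1%:R))) ^+ r].
Proof.
move=> e0 l1; have [net netP] := finite_bowen_net m e0.
pose s0 := [seq (m, bowen_ball T m c eps) | c <- net].
exists (\sum_(p <- s0) expR (- (t * p.1%:R))); elim=> [|r [s [sr sd sc ss]]].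
  exists s0; split; last by rewrite expr0 mulr1.
  - by move=> _ /mapP[c _ ->] /=; rewrite max0n.
  - move=> _ /mapP[c _ ->] z z' /= cz cz' j jm; rewrite mulr_natl mulr2n.
    by apply: mdist_trans_sym; [exact: cz|exact: cz'].
  - move=> z _; have [c cn cz] := netP z.
    by exists (m, bowen_ball T m c eps) => //; apply: map_f.
exists [seq (p.1 + q.1, p.2 `&` [set z | bowen_ball T q.1 q.2 eps (iter p.1 T z)])%N
  | p <- s, q <- l]; split.
- move=> _ /allpairsP[[p q] /= [ps ql ->]] /=.
  have := sr p ps; have := l1 q ql; rewrite !geq_max /= => q0 /andP[pr pm].
  by rewrite (leq_trans pm (leq_addr _ _)) andbT -addn1 leq_add.
- move=> _ /allpairsP[[p q] /= [ps ql ->]] z z' /= [pz qz] [pz' qz'] j jpq.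
  have [jp|pj] := ltnP j p.1; first exact: sd ps _ _ pz pz' _ jp.
  rewrite -(subnK pj) !iterD mulr_natl mulr2n.
  by apply: mdist_trans_sym; [apply: qz|apply: qz'];
    rewrite ltn_subLR.
- move=> z zZ; have [p ps pz] := sc z zZ.
  have mp : (m <= p.1)%N by have := sr p ps; rewrite geq_max => /andP[].
  have [q ql qz] := zZ _ mp.
  exists (p.1 + q.1, p.2 `&` [set z | bowen_ball T q.1 q.2 eps (iter p.1 T z)])%N => //.
  by apply/allpairsP; exists (p, q).
rewrite big_allpairs_dep/= exprSr mulrA.
have -> : \sum_(p <- s) \sum_(q <- l) expR (- (t * (p.1 + q.1)%:R)) =
    (\sum_(p <- s) expR (- (t * p.1%:R))) * \sum_(q <- l) expR (- (t * q.1%:R)).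
  rewrite mulr_suml; apply: eq_bigr => p _; rewrite mulr_sumr.
  by apply: eq_bigr => q _; rewrite natrD mulrDr opprD expRD.
by apply: ler_wpM2r => //; apply: sumr_ge0 => q _; exact: expR_ge0.
Qed.

Lemma itinerary_set_cost0 eps t (l : seq (nat * X)) m n : 0 < eps ->
  {in l, forall p, (1 <= p.1)%N} ->
  \sum_(p <- l) expR (- (t * p.1%:R)) < 1 ->
  bowen_cost T (itinerary_set eps l m) t n (2 * eps) = 0%E.
Proof.
move=> e0 l1 q1; have [K HK] := itinerary_pieces t m e0 l1.
set q := \sum_(p <- l) _ in q1 HK.
have q0 : 0 <= q by apply: sumr_ge0 => p _; exact: expR_ge0.
have [->|/set0P[x0 _]] := eqVneq (itinerary_set eps l m) set0; first exact: bowen_cost_set0.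
have cost_r r : (n <= r)%N ->
    (bowen_cost T (itinerary_set eps l m) t n (2 * eps) <= (K * q ^+ r)%:E)%E.
  move=> nr; have [s [sr sd sc ss]] := HK r.
  pose s' := [seq (p.1, xget x0 p.2) | p <- s].
  apply: (@le_trans _ _ (\sum_(p <- s') expR (- (t * p.1%:R)))%:E).
    apply: bowen_cost_seq => [_ /mapP[p ps ->] /=|z /sc[p ps pz]].
      by apply: leq_trans (sr p ps); rewrite leq_max nr.
    exists (p.1, xget x0 p.2); first exact: map_f.
    by apply: (sd p) => //; exact: xgetI pz.
  by rewrite big_map lee_fin.
apply/eqP; rewrite eq_le bowen_cost_ge0 andbT.
have Kq : (fun r => (K * q ^+ r)%:E) @ \oo --> 0%E.
  apply: cvg_EFin; first by near=> r.
  rewrite -[X in _ --> X](mulr0 K); apply: cvgMr; apply: cvg_expr.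
  by rewrite ger0_norm.
rewrite -(cvg_lim _ Kq)//; apply: lime_ge; first by apply/cvg_ex; exists 0%E.
by near=> r; apply: cost_r; near: r; exact: nbhs_infty_ge.
Unshelve. all: by end_near. Qed.

Lemma omega_limit_nonempty x : omega_limit T x !=set0.
Proof.
have [|y Hy] := @compact_cluster_seq _ _ (fun k => iter k T x) (fun=> True) cX.
  by move=> n; exists n.
exists y => n _ U /nbhs_mdist[e e0 eU]; have [k [nk _ ky]] := Hy e n e0.
by exists (iter k T x); split; [exists k|exact: eU].
Qed.

Lemma omega_limit_closed x : closed (omega_limit T x).
Proof. by apply: closed_bigI => n _; exact: closed_closure. Qed.

Lemma omega_limit_compact x : compact (omega_limit T x).
Proof. exact: subclosed_compact (@omega_limit_closed x) cX _. Qed.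

Lemma omega_limit_cluster x y : 
  (forall (e : R) n, 0 < e -> exists2 k, (n <= k)%N & mdist y (iter k T x) < e) ->
  omega_limit T x y.
Proof.
move=> Hy n _ U /nbhs_mdist[e e0 eU]; have [k nk ky] := Hy e n e0.
by exists (iter k T x); split; [exists k|exact: eU].
Qed.

(** Otherwise the orbit would visit the complement of [U] infinitely often and
    would have a limit point away from the interior of [U]. *)
Lemma omega_limit_eventually x U :
  (forall y, omega_limit T x y -> nbhs y U) ->
  exists m, forall k, (m <= k)%N -> U (iter k T x).
Proof.
move=> HU; apply: contrapT => /forallNP noU.
have [n|y Hy] := @compact_cluster_seq _ _ (fun k => iter k T x)
  (fun k => ~ U (iter k T x)) cX.
  by have := noU n => /existsNP[k /not_implyP[nk Uk]]; exists k.
have /HU/nbhs_mdist[e e0 eU] : omega_limit T x y.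
  apply: omega_limit_cluster => e n e0.
  by have [k [nk _ ky]] := Hy e n e0; exists k.
by have [k [_ nU /eU]] := Hy e 0%N e0.
Qed.

(** A cheap cover of an omega-limit set has a finite subcover, and moving its
    centres to finite nets leaves only countably many candidates: lists of pairs
    of natural numbers. Each point of [E] thus eventually follows one of
    countably many lists of weight less than 1, although its omega-limit set
    may be one of uncountably many. *)
Lemma cost_le_omega_limits E t eps n : 0 < eps ->
  (forall x, E x -> bowen_cost T (omega_limit T x) t 1 (eps / 4) = 0%E) ->
  bowen_cost T E t n eps = 0%E.
Proof.
move=> e0 HE; have e4 : 0 < eps / 4 by lra.
have [->|/set0P[x0 _]] := eqVneq E set0; first exact: bowen_cost_set0.
have /choice[net netP] k := finite_bowen_net k e4.
pose dec (l : seq (nat * nat)) : seq (nat * X) := [seq (p.1, nth x0 (net p.1) p.2) | p <- l].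
pose good l := {in l, forall p : nat * X, (1 <= p.1)%N} /\
   \sum_(p <- l) expR (- (t * p.1%:R)) < 1.
(* [F] is indexed by the codes of pairs of a list and a starting time. *)
pose F i : set X := if @unpickle (seq (nat * nat) * nat)%type i is Some (l, m)
  then [set x | good (dec l) /\ itinerary_set (eps / 2) (dec l) m x] else set0.
have F0 i : bowen_cost T (F i) t n eps = 0%E.
  rewrite /F; case: unpickle => [[l m]|]; last exact: bowen_cost_set0.
  have [[gl1 gl2]|ngl] := pselect (good (dec l)); last first.
    rewrite [X in bowen_cost _ X](_ : _ = set0); last by apply/seteqP; split => // x [].
    exact: bowen_cost_set0.
  apply/eqP; rewrite eq_le bowen_cost_ge0 andbT.
  have e2 : 0 < eps / 2 by lra.
  rewrite -(@itinerary_set_cost0 (eps / 2) t (dec l) m n)// mulrCA divff// mulr1.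
  by apply: bowen_cost_homo_set => x [].
have EF : E `<=` \bigcup_i F i.
  move=> x Ex; have : (bowen_cost T (omega_limit T x) t 1 (eps / 4) < 1%:E)%E by rewrite HE// lte_fin.
  move=> /ereal_inf_lt[_ [C [cC C1 CO] <-] Clt].
  have [|s Cs Os] := @compact_finite_subcover _ _ _ C
    (fun p => bowen_ball T p.1 p.2 (eps / 4)) _ (@omega_limit_compact x).
    by move=> y /CO[p Cp py]; exists p => //; exact: nbhs_bowen_ball.
  have slt : \sum_(p <- undup s) expR (- (t * p.1%:R)) < 1.
    rewrite -lte_fin; apply: le_lt_trans Clt; apply: esum_ge.
    exists [set` undup s]; first split; first exact: finite_seq.
      by move=> p /=; rewrite mem_undup => /Cs.
    by rewrite -fsbig_seq ?undup_uniq// sumEFin.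
  have /choice[g gP] p : exists i, bowen_ball T p.1 (nth x0 (net p.1) i) (eps / 4) p.2.
    have [c cn cp] := netP p.1 p.2; exists (index c (net p.1)).
    by rewrite nth_index.
  pose l := [seq (p.1, g p) | p <- undup s].
  have dl : dec l = [seq (p.1, nth x0 (net p.1) (g p)) | p <- undup s].
    by rewrite /dec /l -map_comp.
  have gl : good (dec l).
    rewrite dl; split; last by rewrite big_map.
    by move=> _ /mapP[p + ->] /=; rewrite mem_undup => /Cs/C1.
  have [|m Hm] := @omega_limit_eventually x
     [set y | exists2 p, p \in dec l & bowen_ball T p.1 p.2 (eps / 2) y].
    move=> y /Os[p ps py]; apply: filterS (nbhs_bowen_ball py) => z pz.
    exists (p.1, nth x0 (net p.1) (g p)).
      by rewrite dl; apply: (map_f (fun p => (p.1, nth x0 (net p.1) (g p)))); rewrite mem_undup.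
    move=> j jp; have -> : eps / 2 = eps / 4 + eps / 4 by lra.
    by apply: mdist_trans_lt; [exact: (gP p)|exact: pz].
  exists (pickle (l, m)) => //; rewrite /F pickleK; split => // k mk.
apply/eqP; rewrite eq_le bowen_cost_ge0 andbT -(bowen_cost_bigcup F0).
exact: bowen_cost_homo_set.
Qed.

(** This plays the part of Bowen's theorem on points all of whose limit measures
    have small entropy, with omega-limit sets in place of measures. *)
Theorem htop_le_omega_limits E (s : R) : E !=set0 ->
  (forall x, E x -> (htop T (omega_limit T x) <= s%:E)%E) -> (htop T E <= s%:E)%E.
Proof.
move=> E0 HE; apply: htop_le => // t eps n st e0.
apply: cost_le_omega_limits => // x /HE xs; apply: bowen_cost_lt_htop.
- exact: omega_limit_nonempty.
- by rewrite divr_gt0.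
- by apply: le_lt_trans xs _; rewrite lte_fin.
Qed.

End OmegaLimitEntropy.

(** * Chains and concatenation of pseudo-orbits *)

Section Walks.
Context {R : realType} {X : metricType R} (T : X -> X).
Implicit Types (d e : R) (w : seq X) (x y z : X).

Definition jump e : rel X := fun a b => mdist (T a) b < e.

(** A chain without its end points: the word [w] starts near [x], and its last
    point is mapped near [y]. The tolerance is [d] at both ends but [2 * d]
    inside, so that words can be concatenated with no loss. *)
Definition walk d x w y : bool :=
  if w is a :: w' then
    [&& mdist x a < d, path (jump (2 * d)) a w' & mdist (T (last a w')) y < d]
  else false.

Definition reaches x y : Prop := forall d, 0 < d -> exists w, walk d x w y.

Lemma walk_size d x w y : walk d x w y -> (0 < size w)%N.
Proof. by case: w. Qed.

Lemma walk_cat d x y z w w' : walk d x w y -> walk d y w' z -> walk d x (w ++ w') z.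
Proof.
case: w => // a w; case: w' => // b w' /and3P[xa pw wy] /and3P[yb pw' wz] /=.
rewrite xa cat_path pw /= last_cat /= wz pw' !andbT /jump mulr_natl mulr2n.
exact: mdist_trans_lt wy yb.
Qed.

Lemma walk_perturb d e x x' y y' w : walk d x w y -> 0 <= e ->
  mdist x' x <= e -> mdist y y' <= e -> walk (d + e) x' w y'.
Proof.
case: w => // a w /and3P[xa pw wy] e0 xx yy /=; apply/and3P; split.
- by rewrite (le_lt_trans (metric_triangle _ x _))// addrC ltr_leD.
- by apply: sub_path pw => b c /lt_le_trans; apply; rewrite ler_pM2l// lerDl.
- by rewrite (le_lt_trans (metric_triangle _ y _))// ltr_leD.
Qed.

Lemma walk_nseq d x w r : (0 < r)%N -> walk d x w x -> walk d x (flatten (nseq r w)) x.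
Proof.
case: r => // r _ xw; elim: r => [|r IH]; first by rewrite /= cats0.
by rewrite [nseq _ _]/= [flatten _]/=; exact: walk_cat xw IH.
Qed.

(** Only the two end points of an orbit segment have to be close to the
    prescribed ends; this is where walks are more convenient than chains. *)
Lemma walk_orbit d x y z n : (0 < n)%N -> mdist x z < d ->
  mdist (iter n T z) y < d -> walk d x (traject T z n) y.
Proof.
case: n => // n _ xz zy.
have d0 : 0 < d by apply: le_lt_trans xz; exact: mdist_ge0.
rewrite trajectS /= xz /= last_traject zy andbT.
elim: n (z) {zy xz} => [//|n IH] a /=; rewrite IH andbT /jump mdistxx.
by rewrite mulr_gt0.
Qed.

Lemma reaches_trans x y z : reaches x y -> reaches y z -> reaches x z.
Proof.
move=> xy yz d d0; have [w xw] := xy d d0; have [w' yw] := yz d d0.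
by exists (w ++ w'); exact: walk_cat xw yw.
Qed.

Lemma reaches_iter x n : (0 < n)%N -> reaches x (iter n T x).
Proof.
by move=> n0 d d0; exists (traject T x n); apply: walk_orbit; rewrite ?mdistxx.
Qed.

Lemma has_chain_walk d x y : has_chain T d x y -> exists w, walk d x w y.
Proof.
move=> [[//|k] [u [// _ <- <- uk]]]; exists (map u (iota 0 k.+1)) => /=.
have d0 : 0 < d by apply: le_lt_trans (uk 0%N _) => //; exact: mdist_ge0.
have -> : last (u 0%N) (map u (iota 1 k)) = u k.
  by rewrite last_map -(last_cons 0%N 0%N) -/(iota 0 k.+1) -nth_last size_iota nth_iota.
rewrite mdistxx d0 /= uk// andbT.
have {uk} : forall i, (i < 0 + k)%N -> mdist (T (u i)) (u i.+1) < d.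
  by move=> i ik; apply: uk; exact: ltnW.
have : d <= 2 * d by rewrite ler_peMl ?ltW// ltr1n.
move: (2 * d) => e de; move: 0%N => m.
elim: k m => [//|k IH] m uk /=.
apply/andP; split; last by apply: IH => i ik; apply: uk; rewrite addnS -addSn.
have /lt_le_trans : mdist (T (u m)) (u m.+1) < d by apply: uk; rewrite addnS ltnS leq_addr.
exact.
Qed.

Lemma path_has_chain d x w : (0 < size w)%N -> path (jump d) x w ->
  has_chain T d x (last x w).
Proof.
move=> w0 /(pathP x) xw; exists (size w), (nth x (x :: w)); split => //.
by rewrite -nth_last /=; case: w w0 {xw}.
Qed.

Hypothesis cT : continuous T.

(** If [w] starts close enough to [x], then [x] may replace the first point of
    [w], by continuity at [x]. *)
Lemma walk_path_start x d : 0 < d -> exists2 d', 0 < d' <= d &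
  forall a w y, walk d' x (a :: w) y ->
    path (jump d) x w /\ mdist (T (last x w)) y < d.
Proof.
move=> d0; have d2 : 0 < d / 2 by lra.
have /nbhs_mdist[r r0 rT] := near_mdist_continuous x cT d2.
exists (Num.min r (d / 4)).
  by rewrite lt_min r0 /= ge_min; apply/andP; split; [|apply/orP; right]; lra.
move=> a w y /and3P[xa pw wy].
have ra : mdist x a < r by move: xa; rewrite lt_min => /andP[].
have /rT Txa := ra.
have le4 : Num.min r (d / 4) <= d / 4 by rewrite ge_min lexx orbT.
split.
  case: w pw {wy} => //= b w /andP[ab pw]; apply/andP; split.
    have -> : d = d / 2 + d / 2 by lra.
    apply: mdist_trans_lt Txa _; apply: lt_le_trans ab _; lra.
  apply: sub_path pw => u v uv; apply: lt_le_trans uv _; lra.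
case: w pw wy => [_ /= wy|b w _ /= wy]; last by apply: lt_le_trans wy _; lra.
have -> : d = d / 2 + d / 2 by lra.
by apply: mdist_trans_lt Txa _; apply: lt_le_trans wy _; lra.
Qed.

Lemma reaches_has_chain x y d : reaches x y -> 0 < d -> has_chain T d x y.
Proof.
move=> xy d0; have [d' /andP[d'0 _] Hd] := walk_path_start x d0.
have [[//|a w] /Hd[pw wy]] := xy d' d'0.
rewrite -(last_rcons x w y); apply: path_has_chain; first by rewrite size_rcons.
by rewrite rcons_path pw.
Qed.

Lemma chain_relatedE x y : chain_related T x y <-> reaches x y /\ reaches y x.
Proof.
split=> [xy|[xy yx] d d0]; last by split; exact: reaches_has_chain.
by split=> d d0; apply: has_chain_walk; have [] := xy d d0.
Qed.

(** The loop is run twice so that dropping its first point leaves a word that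
    is not empty. *)
Lemma reaches_image x : reaches x x -> reaches (T x) x.
Proof.
move=> xx d d0; have [d' /andP[d'0 dd'] Hd] := walk_path_start x d0.
have [w xw] := xx d' d'0; have := walk_cat xw xw.
case: w xw => // a [|b w] _ /Hd[/= /andP[xb pw] wx].
  by exists [:: a]; rewrite /= wx !andbT.
exists (b :: w ++ a :: b :: w); rewrite /= wx andbT; apply/andP; split => //.
by apply: sub_path pw => u v uv; apply: lt_le_trans uv _; lra.
Qed.

Lemma reaches_iter_back x n : reaches x x -> reaches (iter n T x) x.
Proof.
move=> xx; elim: n => [//|n IH] /=; apply: reaches_trans (IH).
apply: reaches_image; case: n IH => [//|n] IH.
by apply: reaches_trans IH _; exact: reaches_iter.
Qed.

(** The orbit of [x] itself leads from near [u] to near [v]. *)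
Lemma omega_limit_reaches x u v : omega_limit T x u -> omega_limit T x v ->
  reaches u v.
Proof.
move=> xu xv d d0.
have near_orbit y n : omega_limit T x y ->
    exists2 k, (n <= k)%N & mdist y (iter k T x) < d.
  move=> /(_ n I (fun z => mdist y z < d))[|_ [[k /= nk <-] yk]]; last by exists k.
  by apply/nbhs_mdist; exists d.
have [k _ uk] := near_orbit u 0%N xu; have [l kl vl] := near_orbit v k.+1 xv.
exists (traject T (iter k T x) (l - k)); apply: walk_orbit => //.
  by rewrite subn_gt0.
by rewrite -iterD subnK 1?ltnW// metric_sym.
Qed.

(** Walks to and from one point of a small ball also serve the other points of
    that ball; finitely many balls cover the space. *)
Lemma uniform_reaches (Y : set X) p d : compact [set: X] -> 0 < d ->
  (forall y, Y y -> reaches p y /\ reaches y p) ->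
  exists M, forall y, Y y ->
    (exists2 w, (size w <= M)%N & walk d p w y) /\
    (exists2 w, (size w <= M)%N & walk d y w p).
Proof.
move=> cX d0 Yp; have d4 : 0 < d / 4 by lra.
pose P c M := forall y, Y y -> mdist c y < d / 4 ->
    (exists2 w, (size w <= M)%N & walk d p w y) /\
    (exists2 w, (size w <= M)%N & walk d y w p).
have PM c : exists M, P c M.
  have [[y0 [Y0 cy0]]|noy] := pselect (exists y, Y y /\ mdist c y < d / 4); last first.
    by exists 0%N => y Yy cy; exfalso; apply: noy; exists y.
  have d2 : 0 < d / 2 by lra.
  have [/(_ _ d2)[w pw] /(_ _ d2)[w' pw']] := Yp _ Y0.
  exists (maxn (size w) (size w')) => y Yy cy.
  have d2' : 0 <= d / 2 by lra.
  have yy : mdist y y0 <= d / 2.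
    by apply: ltW; have -> : d / 2 = d / 4 + d / 4 by [lra]; exact: mdist_trans_sym cy cy0.
  split; [exists w|exists w']; rewrite ?leq_max ?leqnn ?orbT// (splitr d).
    by apply: (walk_perturb pw) => //; [rewrite mdistxx|rewrite metric_sym].
  by apply: (walk_perturb pw') => //; rewrite mdistxx.
have Pmono c M M' : (M <= M')%N -> P c M -> P c M'.
  move=> MM PM' y Yy cy; have [[w wM pw] [w' wM' pw']] := PM' y Yy cy.
  by split; [exists w|exists w'] => //; exact: leq_trans MM.
have [|s _ sX] := @compact_finite_subcover _ _ _ setT (fun c => [set z | mdist c z < d / 4]) _ cX.
  by move=> x _; exists x => //; apply/nbhs_mdist; exists (d / 4).
have [M HM] : exists M, {in s, forall c, P c M}.
  elim: s {sX} => [|c s [M HM]]; first by exists 0%N.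
  have [M' HM'] := PM c; exists (maxn M M') => b; rewrite inE => /predU1P[->|/HM].
    by apply: Pmono HM'; rewrite leq_maxr.
  by apply: Pmono; rewrite leq_maxl.
by exists M => y Yy; have [c cs cy] := sX y I; exact: (HM c).
Qed.

(** Concatenating loops at [p] of a common length yields a pseudo-orbit; the
    common length makes the position inside the pseudo-orbit computable. *)
Definition concat_loops (p : X) (L : nat) (B : nat -> seq X) n : X :=
  nth p (B (n %/ L)%N) (n %% L)%N.

Lemma concat_loops_pseudo_orbit p L B d : 
  (forall k, size (B k) = L) -> (forall k, walk d p (B k) p) ->
  pseudo_orbit T (2 * d) (concat_loops p L B).
Proof.
move=> BL Bp n; rewrite /concat_loops.
have L0 : (0 < L)%N by rewrite -(BL 0%N); exact: walk_size (Bp 0%N).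
move: (n %/ L)%N (n %% L)%N (ltn_pmod n L0) (divn_eq n L) => k i iL ->.
have [iL1|] := ltnP i.+1 L.
  rewrite -addnS modnMDl divnMDl// modn_small// divn_small// addn0.
have := Bp k; move: iL1; rewrite -(BL k); case: (B k) => // a w aL.
  by move=> /and3P[_ /(pathP p) aw _]; apply: aw.
rewrite leq_eqVlt ltnNge iL orbF => /eqP Li.
rewrite -addnS -Li addnC -mulSn modnMl mulnK//.
have := Bp k; have := BL k; case: (B k) => // a w aw /and3P[_ _ wp].
have := Bp k.+1; case: (B k.+1) => // b w' /and3P[pb _ _].
have -> : nth p (a :: w) i = last a w.
  by rewrite -(last_cons p) -nth_last aw Li.
by rewrite mulr_natl mulr2n; exact: mdist_trans_lt wp pb.
Qed.

End Walks.

(** * Entropy of coded sets *)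

Section Codings.
Context {R : realType} {X : metricType R} (T : X -> X).
Variables (N L : nat) (Z : (nat -> 'I_N) -> X) (eps s : R).
Hypotheses (N0 : (0 < N)%N) (L0 : (0 < L)%N) (s0 : 0 <= s).
Hypothesis sL : expR (s * L%:R) <= N%:R.
Hypothesis Zsep : forall k v c om om', (k * L <= v)%N ->
  bowen_ball T v c eps (Z om) -> bowen_ball T v c eps (Z om') ->
  forall i, (i < k)%N -> om i = om' i.

Local Notation c := (expR (- (s * L%:R))).
Local Notation level p := (p.1 %/ L)%N.

(** The symbolic coding is measured through its traces: a code starting with [w]
    has a point in the ball [p]. *)
Definition meets (w : seq 'I_N) (p : nat * X) : Prop :=
  exists om, mkseq om (size w) = w /\ bowen_ball T p.1 p.2 eps (Z om).

(** The conditional weight of the ball [p] given that the code starts with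
    [w], for the uniform measure on codes and up to the factor [c]: once [w]
    fixes all the symbols that [p] determines, [p] counts fully. *)
Definition weight (w : seq 'I_N) (p : nat * X) : R :=
  if `[< meets w p >] then c * N%:R ^- (level p - size w) else 0.

Lemma weight_ge0 w p : 0 <= weight w p.
Proof.
by rewrite /weight; case: ifP => // _.
Qed.

Lemma meets_rcons w a p : meets (rcons w a) p -> meets w p.
Proof.
move=> [om []]; rewrite size_rcons => omw pom; exists om; split => //.
move: omw; rewrite /mkseq -addn1 iotaD map_cat/= cats1 => /rcons_inj[].
by [].
Qed.

Lemma meets_next w a p om : (size w < level p)%N -> meets (rcons w a) p ->
  bowen_ball T p.1 p.2 eps (Z om) -> a = om (size w).
Proof.
move=> wp [om' []]; rewrite size_rcons => omw pom' pom.
have := Zsep (leq_trunc_div _ _) pom' pom wp => <-.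
have := congr1 (fun u => nth a u (size w)) omw.
by rewrite nth_mkseq// nth_rcons ltnn eqxx.
Qed.

(** Averaging over the next symbol does not increase the weight. If [p] is not
    yet determined by [w], then a single next symbol is compatible with it, and
    the weight for that symbol grows by the factor [N]. *)
Lemma sum_weight_rcons w p :
  \sum_(a : 'I_N) weight (rcons w a) p <= \sum_(a : 'I_N) weight w p.
Proof.
have [wp|nwp] := pselect (meets w p); last first.
  apply: ler_sum => a _; rewrite /weight.
  case: asboolP => [/meets_rcons //|_]; by case: asboolP.
have NR : 0 < N%:R :> R by rewrite ltr0n.
have [pw|wpl] := leqP (level p) (size w).
  apply: ler_sum => a _; rewrite /weight (asboolT wp) size_rcons.
  move/eqP : (pw) => ->; rewrite expr0 invr1 mulr1.
  case: ifP => _; last exact: expR_ge0.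
  by move/eqP : (leqW pw) => ->; rewrite expr0 invr1 mulr1.
have [om [omw pom]] := wp.
rewrite (bigD1 (om (size w)))//= big1 ?addr0; last first.
  move=> a /eqP aom; rewrite /weight; case: asboolP => // /meets_next/(_ pom).
  by move/(_ wpl).
rewrite [leRHS]big_const_ord iter_addr_0 /weight (asboolT wp) size_rcons.
have -> : c * N%:R ^- (level p - size w) *+ N = c * N%:R ^- (level p - (size w).+1).
  rewrite -(subnSK wpl) exprS invfM -mulr_natr.
  by move: (N%:R ^- _) (gt_eqF NR) => y /negbT N0R; field.
by case: ifP.
Qed.

Lemma weight_nil p t : t <= s -> weight [::] p <= expR (- (t * p.1%:R)).
Proof.
move=> ts; rewrite /weight subn0; case: ifP => _; last exact: expR_ge0.
apply: (@le_trans _ _ (c * expR (- (s * (level p * L)%:R)))).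
  rewrite ler_pM2l ?expR_gt0// natrM mulrCA mulrC expRN lef_pV2 ?posrE ?expR_gt0 ?exprn_gt0 ?ltr0n//.
  rewrite mulrC expRM_natl lerXn2r// nnegrE ?expR_ge0//.
rewrite -expRD ler_expR -opprD lerN2 -mulrDr -natrD.
apply: (@le_trans _ _ (s * p.1%:R)); first by rewrite ler_wpM2r.
rewrite ler_wpM2l// ler_nat -mulSn; apply: ltnW; exact: ltn_ceil.
Qed.

(** A mass distribution principle without measures. If a cover is too cheap, the
    symbols of a code can be chosen one after the other so that the total weight
    of the cover given the prefix stays below [c]; a ball that contains the
    point of that code would have weight [c] in the end. *)
Lemma coded_cost_ge (E : set X) t n : t <= s -> (forall om, E (Z om)) ->
  (c%:E <= bowen_cost T E t n eps)%E.
Proof.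
move=> ts EZ; apply: le_ereal_inf_tmp => _ [C [_ _ EC] <-].
rewrite leNgt; apply/negP => Cc.
pose f w : \bar R := (\esum_(p in C) (weight w p)%:E)%E.
have f_nil : (f [::] < c%:E)%E.
  by apply: le_lt_trans Cc; apply: le_esum => p _; rewrite lee_fin weight_nil.
have f_ge0 w : (0 <= f w)%E by apply: esum_ge0 => p _; rewrite lee_fin weight_ge0.
have next w : exists a, (f w < c%:E -> f (rcons w a) < c%:E)%E.
  have [fw|fw] := ltP (f w) c%:E; last by exists (Ordinal N0).
  apply: contrapT => /forallNP fa.
  have {}fa a : (c%:E <= f (rcons w a))%E.
    by rewrite leNgt; apply/negP => fwa; apply: (fa a).
  have : (\sum_(a : 'I_N) c%:E <= \sum_(a : 'I_N) f w)%E.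
    apply: (@le_trans _ _ (\sum_(a : 'I_N) f (rcons w a))%E).
      by apply: lee_sum => a _; exact: fa.
    rewrite /f -!esum_sum; try by move=> p a _ _; rewrite lee_fin weight_ge0.
    by apply: le_esum => p _; rewrite !sumEFin lee_fin sum_weight_rcons.
  case: (f w) fw (f_ge0 w) => // x; rewrite lte_fin => xc _.
  by rewrite !sumEFin lee_fin !big_const_ord !iter_addr_0 lerMn2r -leqn0 leqNgt N0 leNgt xc.
have [g Hg] := choice next.
pose W := fix W m := if m is m'.+1 then rcons (W m') (g (W m')) else [::].
pose om m := g (W m).
have Wom m : mkseq om m = W m.
  elim: m => [|m IH]; first by [].
  by rewrite /mkseq -addn1 iotaD map_cat cats1 addn1 -/(mkseq om m) IH.
have sW m : size (W m) = m by rewrite -Wom size_mkseq.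
have fW m : (f (W m) < c%:E)%E by elim: m => [//|m IH] /=; exact: Hg.
have [p Cp pom] := EC _ (EZ om).
have := fW (level p); rewrite ltNge => /negP; apply.
apply: esum_ge; exists [set p]; first by split => // _ ->.
rewrite fsbig_set1 lee_fin /weight asboolT ?sW ?subnn ?expr0 ?invr1 ?mulr1//.
by exists om; rewrite sW Wom.
Qed.

End Codings.

Lemma htop_ge_coding {R : realType} {X : metricType R} (T : X -> X) (E : set X)
    (N L : nat) (Z : (nat -> 'I_N) -> X) (eps s : R) :
  (0 < N)%N -> (0 < L)%N -> 0 <= s -> 0 < eps -> expR (s * L%:R) <= N%:R ->
  (forall k v c om om', (k * L <= v)%N ->
    bowen_ball T v c eps (Z om) -> bowen_ball T v c eps (Z om') ->
    forall i, (i < k)%N -> om i = om' i) ->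
  (forall om, E (Z om)) -> (s%:E <= htop T E)%E.
Proof.
move=> N0 L0 s0 e0 sL Zsep EZ; apply: (@htop_ge _ _ _ _ _ eps) => //.
  by exists (Z (fun=> Ordinal N0)).
move=> t ts; exists 0%N; rewrite gt_eqF//.
apply: lt_le_trans (coded_cost_ge N0 L0 s0 sL Zsep 0 (ltW ts) EZ).
by rewrite lte_fin expR_gt0.
Qed.

(** * Oscillating averages *)

Section Oscillation.
Context {R : realType}.

(** With [inf S] the upper limit, divergence forces the sequence to leave a
    neighbourhood of [inf S] infinitely often, necessarily downwards, while it
    comes back arbitrarily close infinitely often. *)
Lemma bounded_divergent_oscillates (A : nat -> R) (M : R) :
  (forall n, `|A n| <= M) -> ~ cvgn A ->
  exists a b, [/\ a < b, forall n, exists2 k, (n <= k)%N & A k < a &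
                  forall n, exists2 k, (n <= k)%N & b < A k].
Proof.
move=> AM nA.
pose S : set R := [set c | exists n, forall k, (n <= k)%N -> A k <= c].
have infS : has_inf S.
  split; first by exists M; exists 0%N => k _; apply: le_trans (AM k); exact: ler_norm.
  exists (- M) => c [n An]; apply: le_trans (An n (leqnn n)).
  by have := AM n; rewrite ler_norml => /andP[].
have [e [e0 He]] : exists e, 0 < e /\ forall n, exists2 k, (n <= k)%N & e <= `|inf S - A k|.
  apply: contrapT => noe; apply: nA; apply/cvg_ex; exists (inf S).
  apply/cvgrPdist_lt => e e0; apply: contrapT => ne; apply: noe; exists e; split => // n.
  apply: contrapT => /forall2NP nk; apply: ne; exists n => // k nk'.
  by have [//|/negP] := nk k; rewrite -ltNge.
have [c [n0 cn0] ce] := inf_adherent e0 infS.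
exists (inf S - e / 2), (inf S - e / 4); split; first lra.
  move=> n; have [k nk ek] := He (maxn n n0).
  move: nk; rewrite geq_max => /andP[nk /cn0 Ak]; exists k => //.
  by move: ek; rewrite real_ler_normr ?num_real// => /orP[] ?; lra.
move=> n; apply: contrapT => /forall2NP nb.
have : S (inf S - e / 4).
  by exists n => k nk; have [//|/negP] := nb k; rewrite -leNgt.
by move/(ge_inf infS.2); lra.
Qed.

(** Constant on the successive intervals between powers of 4, each of which
    makes up three quarters of all the indices below its end. *)
Definition schedule (j : nat) : bool := odd (trunc_log 4 j.+1).

Lemma schedule_count m : exists2 r, (r < 4 ^ m)%N &
  (\sum_(j < (4 ^ m.+1).-1) schedule j = r + 3 * 4 ^ m * odd m)%N.
Proof.
have p4 : (0 < 4 ^ m)%N by rewrite expn_gt0.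
exists (\sum_(0 <= j < (4 ^ m).-1) schedule j)%N.
  apply: (@leq_ltn_trans (\sum_(0 <= j < (4 ^ m).-1) 1)%N); last first.
    by rewrite sum_nat_const_nat muln1 subn0; lia.
  by apply: leq_sum => j _; case: schedule.
rewrite -(big_mkord xpredT (fun j => nat_of_bool (schedule j))).
rewrite (big_cat_nat (n := (4 ^ m).-1))//=; last by rewrite expnS; lia.
congr (_ + _)%N; rewrite (eq_big_nat _ _ (F2 := fun=> nat_of_bool (odd m))).
  by rewrite sum_nat_const_nat expnS; congr (_ * _)%N; lia.
move=> j /andP[j1 j2]; rewrite /schedule; congr (nat_of_bool (odd _)).
by apply: trunc_log_eq => //; apply/andP; split; rewrite expnS in j2 *; lia.
Qed.

Lemma schedule_rare n : exists2 k, (n <= k)%N &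
  (0 < k)%N /\ (4 * \sum_(j < k) schedule j <= k)%N.
Proof.
have [r r4 Hr] := schedule_count n.*2; exists (4 ^ n.*2.+1).-1.
  have := ltn_expl n.*2.+1 (isT : 1 < 4)%N; lia.
rewrite Hr odd_double muln0 expnS; lia.
Qed.

Lemma schedule_frequent n : exists2 k, (n <= k)%N &
  (0 < k)%N /\ (3 * k <= 4 * \sum_(j < k) schedule j)%N.
Proof.
have [r r4 Hr] := schedule_count n.*2.+1; exists (4 ^ n.*2.+2).-1.
  have := ltn_expl n.*2.+2 (isT : 1 < 4)%N; lia.
rewrite Hr /= odd_double /= muln1 expnS; lia.
Qed.

(** If both averages converged, then so would their difference, which is
    [D / L] times the frequency of the schedule up to an error [2 * eta]. That
    frequency is infinitely often at most 1/4 and infinitely often at least 3/4,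
    and [8 * eta < D / L] keeps the two cases apart. *)
Lemma schedule_not_both_cvg (S0 S1 : nat -> R) (L : nat) (D eta : R) :
  (0 < L)%N -> 8 * eta * L%:R < D ->
  (forall k, `|S1 (k * L)%N - S0 (k * L)%N - D * (\sum_(j < k) schedule j)%:R|
     <= 2 * eta * (k * L)%:R) ->
  ~ cvgn (fun n => n%:R^-1 * S0 n) \/ ~ cvgn (fun n => n%:R^-1 * S1 n).
Proof.
move=> L0 DL HS; apply: contrapT => /not_orP[/contrapT/cvg_ex[l0 c0] /contrapT/cvg_ex[l1 c1]].
have LR : 0 < L%:R :> R by rewrite ltr0n.
pose q := D / L%:R; pose e := (q - 8 * eta) / 16.
have q8 : 8 * eta < q by rewrite /q ltr_pdivlMr.
have e0 : 0 < e by rewrite /e; lra.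
have /cvgrPdist_lt/(_ e e0)[n0 _ H0] := c0.
have /cvgrPdist_lt/(_ e e0)[n1 _ H1] := c1.
have key k : (maxn n0 n1 <= k)%N -> (0 < k)%N ->
    `|q * ((\sum_(j < k) schedule j)%:R / k%:R) - (l1 - l0)| <= 2 * eta + 2 * e.
  rewrite geq_max => /andP[n0k n1k] k0.
  have kkL : (k <= k * L)%N by rewrite leq_pmulr.
  have kLR : 0 < (k * L)%:R :> R by rewrite ltr0n muln_gt0 k0.
  have : `|(S1 (k * L)%N - S0 (k * L)%N - D * (\sum_(j < k) schedule j)%:R) /
      (k * L)%:R| <= 2 * eta.
    by rewrite normrM normfV (ger0_norm (ltW kLR)) ler_pdivrMr.
  have -> : (S1 (k * L)%N - S0 (k * L)%N - D * (\sum_(j < k) schedule j)%:R) /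
      (k * L)%:R = (k * L)%:R^-1 * S1 (k * L)%N - (k * L)%:R^-1 * S0 (k * L)%N -
        q * ((\sum_(j < k) schedule j)%:R / k%:R).
    rewrite /q natrM; field.
    by rewrite !pnatr_eq0 -!lt0n k0 L0.
  have := H0 _ (leq_trans n0k kkL); have := H1 _ (leq_trans n1k kkL) => /=.
  rewrite ltr_norml => /andP[? ?]; rewrite ltr_norml => /andP[? ?].
  rewrite ler_norml => /andP[? ?].
  by rewrite ler_norml; apply/andP; split; lra.
have [k nk [k0 rare]] := schedule_rare (maxn n0 n1).
have [k' nk' [k0' freq]] := schedule_frequent (maxn n0 n1).
have rareR : (\sum_(j < k) schedule j)%:R / k%:R <= 1 / 4 :> R.
  by rewrite ler_pdivrMr ?ltr0n// mul1r ler_pdivlMl ?ltr0n// -natrM ler_nat.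
have freqR : 3 / 4 <= (\sum_(j < k') schedule j)%:R / k'%:R :> R.
  rewrite ler_pdivlMr ?ltr0n// mulrAC ler_pdivrMr// -!natrM ler_nat mulnC.
  by rewrite [leqRHS]mulnC mulnC.
have := key _ nk k0; have := key _ nk' k0'.
rewrite !ler_norml => /andP[h1 h2] /andP[h3 h4].
have eta0 : 0 <= eta.
  have := HS 1%N; rewrite mul1n => /(le_trans (normr_ge0 _)).
  by rewrite pmulr_lge0// pmulr_rge0.
have q0 : 0 < q by lra.
have := ler_wpM2l (ltW q0) rareR; have := ler_wpM2l (ltW q0) freqR.
by rewrite /e in h1 h2 h3 h4; lra.
Qed.

End Oscillation.

(** * Irregular points from blocks *)

Section BlockCoding.
Context {R : realType} {X : metricType R} (T : X -> X) (Phi : X -> R).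

Lemma sum_concat_loops p L (B : nat -> seq X) k : (forall j, size (B j) = L) ->
  \sum_(i < k * L) Phi (concat_loops p L B i) =
  \sum_(j < k) \sum_(x <- B j) Phi x.
Proof.
move=> BL; elim: k => [|k IH]; first by rewrite mul0n !big_ord0.
rewrite big_ord_recr -IH mulSnr /= -!(big_mkord xpredT (fun i => Phi (concat_loops p L B i))).
rewrite (big_cat_nat (n := (k * L)%N)) ?leq_addr//=; congr (_ + _).
rewrite -{1}[(k * L)%N]add0n big_addn addKn (big_nth p) BL.
apply: eq_big_nat => i /andP[_ iL]; rewrite /concat_loops addnC.
by rewrite modnMDl divnMDl ?(leq_ltn_trans _ iL)// modn_small// divn_small// addn0.
Qed.

(** A code [om] selects the blocks [W (om k) (sg k)], where the schedule [sg] is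
    free. For each code, the constant schedule and the oscillating one give
    traced points whose averages differ by an oscillating amount, whatever the
    averages of the code itself do; hence at least one of them is irregular.
    Both choices carry the code, since the separation of distinct symbols does
    not depend on the schedule. *)
Lemma htop_irregular_ge_blocks (p : X) (N L : nat) (W : 'I_N -> bool -> seq X)
    (d eps0 eps eps' eta D s : R) :
  (forall i b, size (W i b) = L) -> (forall i b, walk T d p (W i b) p) ->
  (forall u, pseudo_orbit T (2 * d) u ->
     exists y, forall n, mdist (iter n T y) (u n) < eps) ->
  (forall x y, mdist x y < eps -> `|Phi x - Phi y| < eta) ->
  (forall i, \sum_(x <- W i true) Phi x - \sum_(x <- W i false) Phi x = D) ->
  8 * eta * L%:R < D ->
  (forall i i', i != i' -> exists2 j, (j < L)%N &
     forall b b', eps0 <= mdist (nth p (W i b) j) (nth p (W i' b') j)) ->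
  0 < eps' -> 2 * eps + 2 * eps' <= eps0 ->
  (0 < N)%N -> 0 <= s -> expR (s * L%:R) <= N%:R ->
  (s%:E <= htop T (irregular_set T Phi))%E.
Proof.
move=> WL Wp shadow PhiU WD DL Wsep e'0 eps0' N0 s0 sN.
have L0 : (0 < L)%N by rewrite -(WL (Ordinal N0) true); exact: walk_size (Wp _ _).
pose u (om : nat -> 'I_N) (sg : nat -> bool) :=
  concat_loops p L (fun k => W (om k) (sg k)).
have usum om sg k : \sum_(i < k * L) Phi (u om sg i) =
    \sum_(j < k) \sum_(x <- W (om j) (sg j)) Phi x.
  by rewrite sum_concat_loops.
have trace om sg : exists y, forall n, mdist (iter n T y) (u om sg n) < eps.
  exact/shadow/concat_loops_pseudo_orbit.
have trace_sum om sg y k : (forall n, mdist (iter n T y) (u om sg n) < eps) ->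
    `|\sum_(i < k * L) Phi (iter i T y) - \sum_(j < k) \sum_(x <- W (om j) (sg j)) Phi x|
      <= eta * (k * L)%:R.
  move=> yu; rewrite -usum -sumrB (le_trans (ler_norm_sum _ _ _))//.
  apply: (@le_trans _ _ (\sum_(i < k * L) eta)).
    by apply: ler_sum => i _; exact/ltW/PhiU.
  by rewrite big_const_ord iter_addr_0 mulr_natr.
have /choice[Z HZ] om : exists y, irregular_set T Phi y /\
    exists sg, forall n, mdist (iter n T y) (u om sg n) < eps.
  have [y0 Hy0] := trace om (fun=> false); have [y1 Hy1] := trace om schedule.
  have [] := @schedule_not_both_cvg _ (fun n => \sum_(i < n) Phi (iter i T y0))
    (fun n => \sum_(i < n) Phi (iter i T y1)) L D eta L0 DL.
  - move=> k; have := trace_sum _ _ _ k Hy0; have := trace_sum _ _ _ k Hy1.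
    have -> : \sum_(j < k) \sum_(x <- W (om j) (schedule j)) Phi x =
        \sum_(j < k) \sum_(x <- W (om j) false) Phi x
        + D * (\sum_(j < k) schedule j)%:R.
      rewrite natr_sum mulr_sumr -big_split/=; apply: eq_bigr => j _.
      by case: schedule; rewrite ?mulr0 ?addr0// mulr1 -(WD (om j)) addrC subrK.
    by rewrite !ler_norml => /andP[? ?] /andP[? ?]; apply/andP; split; lra.
  - by exists y0; split => //; exists (fun=> false).
  - by exists y1; split => //; exists schedule.
apply: (@htop_ge_coding _ _ _ _ N L Z eps' s) => //; last by move=> om; have [] := HZ om.
move=> k v c om om' kLv cZ cZ' i ik; apply/eqP/negPn/negP => /Wsep[j jL].
have [_ [sg Hsg]] := HZ om; have [_ [sg' Hsg']] := HZ om'.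
move=> /(_ (sg i) (sg' i)); apply/negP; rewrite -ltNge.
have nv : (i * L + j < v)%N.
  by apply: leq_trans kLv; apply: leq_trans (leq_mul ik (leqnn L)); rewrite mulSnr ltn_add2l.
have uE om1 sg1 : u om1 sg1 (i * L + j)%N = nth p (W (om1 i) (sg1 i)) j.
  by rewrite /u /concat_loops modnMDl divnMDl// modn_small// divn_small// addn0.
rewrite -!uE; apply: lt_le_trans eps0'.
have -> : 2 * eps + 2 * eps' = (eps + eps') + (eps' + eps) by lra.
apply: (@mdist_trans_lt _ _ _ (iter (i * L + j) T c)).
  by apply: (mdist_trans_sym (Hsg _)); rewrite metric_sym; exact: cZ.
by apply: mdist_trans_lt (Hsg' _); exact: cZ'.
Qed.

End BlockCoding.

(** * Entropy of the irregular set from below *)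

Lemma pigeonhole_filter (I : eqType) (C : finType) (f : I -> C) (s : seq I) :
  (0 < #|C|)%N -> exists c, (size s <= #|C| * size [seq x <- s | f x == c])%N.
Proof.
move=> C0; apply: contrapT => /forallNP no.
have sum_count : (\sum_(c : C) size [seq x <- s | f x == c] = size s)%N.
  elim: s {no} => [|x s IH] /=; first by rewrite big1.
  rewrite (bigD1 (f x))//= eqxx /= -[in RHS]IH [in RHS](bigD1 (f x))//= addSn.
  by congr (_ + _).+1; apply: eq_bigr => c; rewrite eq_sym => /negbTE ->.
have : (\sum_(c : C) (#|C| * size [seq x <- s | f x == c]).+1 <= \sum_(c : C) size s)%N.
  by apply: leq_sum => c _; rewrite ltnNge; apply/negP/no.
rewrite sum_nat_const.
have -> : (\sum_(c : C) (#|C| * size [seq x <- s | f x == c]).+1 = #|C| * size s + #|C|)%N.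
  rewrite -sum_count big_distrr/= -[X in (_ + X)%N]muln1 -sum_nat_const -big_split/=.
  by apply: eq_bigr => c _; rewrite addn1.
by rewrite -[leqRHS]addn0 leq_add2l leqNgt C0.
Qed.

Lemma sum_flatten_nseq (R : realType) (X : Type) (f : X -> R) r (w : seq X) :
  \sum_(x <- flatten (nseq r w)) f x = r%:R * \sum_(x <- w) f x.
Proof.
elim: r => [|r IH]; first by rewrite big_nil mul0r.
by rewrite /= big_cat/= IH -[r.+1]add1n natrD mulrDl mul1r.
Qed.

Lemma size_flatten_nseq (X : Type) r (w : seq X) :
  size (flatten (nseq r w)) = (r * size w)%N.
Proof. by elim: r => [//|r IH]; rewrite /= size_cat IH mulSn. Qed.

Section SeparatedSets.
Context {R : realType} {X : metricType R} (T : X -> X).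

Definition separated n (eps : R) (s : seq X) :=
  uniq s /\ {in s &, forall x y, x != y -> ~ bowen_ball T n x eps y}.

(** A separated set that does not cover can be enlarged. *)
Lemma separated_or_covered (E : set X) n (eps : R) N : 0 < eps ->
  (exists s, [/\ size s = N, {in s, forall x, E x} & separated n eps s]) \/
  (exists2 s : seq X, (size s < N)%N &
     forall x, E x -> exists2 c, c \in s & bowen_ball T n c eps x).
Proof.
move=> e0; elim: N => [|N [[s [sN sE [us ss]]]|[s sN sE]]]; last 2 first.
- have [Es|nEs] := pselect (forall x, E x -> exists2 c, c \in s & bowen_ball T n c eps x).
    by right; exists s; rewrite ?sN.
  left; move: nEs => /existsNP[x /not_implyP[Ex /forall2NP xs]].
  have nx c : c \in s -> ~ bowen_ball T n c eps x by move=> cs; have [] := xs c.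
  exists (x :: s); split; first by rewrite /= sN.
    by move=> y; rewrite inE => /predU1P[->//|]; exact: sE.
  split; first by rewrite /= us andbT; apply/negP => /nx; apply; exact: bowen_ball_center.
  move=> y z; rewrite !inE => /predU1P[->|ys] /predU1P[->|zs].
  + by rewrite eqxx.
  + by move=> _ xz; apply: (nx z zs) => j jn; rewrite metric_sym; exact: xz.
  + by move=> _; exact: nx.
  + exact: ss.
- by right; exists s => //; exact: leqW.
- by left; exists [::].
Qed.

(** Bowen's definition is used here with balls of a single length: a positive
    lower bound for the costs becomes an exponential lower bound for the number
    of separated points. *)
Lemma many_separated (E : set X) (s eps c : R) n N : 0 < eps ->
  (c%:E <= bowen_cost T E s n eps)%E -> N%:R * expR (- (s * n%:R)) <= c ->
  exists t, [/\ size t = N, {in t, forall x, E x} & separated n eps t].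
Proof.
move=> e0 cE Nc; have [//|[t tN tE]] := separated_or_covered E n N e0.
have : (c%:E <= (\sum_(p <- [seq (n, x) | x <- t]) expR (- (s * p.1%:R)))%:E)%E.
  apply: le_trans cE _; apply: bowen_cost_seq => [_ /mapP[x _ ->]//|x /tE[y yt yx]].
  by exists (n, y) => //; exact: map_f.
rewrite lee_fin big_map /= big_const_seq count_predT iter_addr_0 -[_ *+ size t]mulr_natl.
by move=> /(le_trans Nc); rewrite ler_pM2r ?expR_gt0// ler_nat leqNgt tN.
Qed.

End SeparatedSets.

Section LowerBound.
Context {R : realType} {X : metricType R} (T : X -> X) (Phi : X -> R).
Hypotheses (cX : compact [set: X]) (cT : continuous T) (cPhi : continuous Phi).

Lemma sum_traject x k n :
  \sum_(z <- traject T (iter k T x) n) Phi z =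
  \sum_(i < k + n) Phi (iter i T x) - \sum_(i < k) Phi (iter i T x).
Proof.
elim: n => [|n IH]; first by rewrite big_nil addn0 subrr.
by rewrite trajectSr -cats1 big_cat big_seq1 IH addnS big_ord_recr /= -iterD addnC addrAC.
Qed.

Lemma irregular_oscillates x : irregular_set T Phi x -> exists a b, [/\ a < b,
  forall n, exists2 k, (n <= k)%N & \sum_(i < k) Phi (iter i T x) < k%:R * a &
  forall n, exists2 k, (n <= k)%N & k%:R * b < \sum_(i < k) Phi (iter i T x)].
Proof.
move=> ix; have [M M0 PM] := compact_norm_le cX cPhi.
have [|a [b [ab Ha Hb]]] := @bounded_divergent_oscillates _ (birkhoff_average T Phi x) M _ ix.
  move=> n; rewrite /birkhoff_average normrM normfV normr_nat.
  have [->|n0] := posnP n; first by rewrite invr0 mul0r ltW.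
  rewrite ler_pdivrMl ?ltr0n// (le_trans (ler_norm_sum _ _ _))//.
  apply: (@le_trans _ _ (\sum_(i < n) M)); first by apply: ler_sum => i _; exact: PM.
  by rewrite big_const_ord iter_addr_0 mulr_natl.
exists a, b; split => // n.
  have [k nk] := Ha (maxn n 1); move: nk; rewrite geq_max => /andP[nk k0] ak.
  by exists k => //; move: ak; rewrite /birkhoff_average mulrC ltr_pdivrMr ?ltr0n// mulrC.
have [k nk] := Hb (maxn n 1); move: nk; rewrite geq_max => /andP[nk k0] ak.
by exists k => //; move: ak; rewrite /birkhoff_average mulrC ltr_pdivlMr ?ltr0n// mulrC.
Qed.

(** Loops at a limit point [p] follow the orbit of [x] from a time when it is
    near [p] up to a much later time at which its average is low, respectively
    high. Low averages can be taken at returns near [p]; high ones occur near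
    another limit point [q], from which a fixed walk leads back. Repeating each
    loop as often as the other is long equalizes the lengths. The gap [g] does
    not depend on [d], although the loops do. *)
Lemma two_loops x : irregular_set T Phi x -> exists p (g : R),
  [/\ omega_limit T x p, 0 < g & forall d : R, 0 < d -> exists l0 l1 : seq X,
    [/\ walk T d p l0 p, walk T d p l1 p, size l0 = size l1 &
        g * (size l0)%:R <= \sum_(z <- l1) Phi z - \sum_(z <- l0) Phi z]].
Proof.
move=> /irregular_oscillates[a [b [ab Ha Hb]]].
set S := fun k => \sum_(i < k) Phi (iter i T x) in Ha Hb.
have [p Hp] := @compact_cluster_seq _ _ (fun k => iter k T x) (fun k => S k < k%:R * a) cX Ha.
have [q Hq] := @compact_cluster_seq _ _ (fun k => iter k T x) (fun k => k%:R * b < S k) cX Hb.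
have xp : omega_limit T x p.
  by apply: omega_limit_cluster => e n e0; have [k [nk _ ky]] := Hp e n e0; exists k.
have xq : omega_limit T x q.
  by apply: omega_limit_cluster => e n e0; have [k [nk _ ky]] := Hq e n e0; exists k.
pose g := (b - a) / 3; have g0 : 0 < g by rewrite /g; lra.
exists p, g; split => // d d0.
have [k1 [_ _ pk1]] := Hp d 0%N d0.
have [w qw] := omega_limit_reaches xq xp d0.
have long (C : R) : exists n : nat, forall k, (n <= k)%N -> C <= g * k%:R.
  exists (Num.trunc `|C / g|).+1 => k nk.
  have kR : `|C / g| <= k%:R.
    by apply: le_trans (ltW (truncnS_gt _)) _; rewrite ler_nat.
  rewrite -ler_pdivrMl// mulrC; apply: le_trans kR; exact: ler_norm.
(* As [b - 2 * g = a + g], a late enough return absorbs the first [k1] terms. *)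
have [w0 [pw0 w0_avg]] : exists w0, walk T d p w0 p /\
    \sum_(z <- w0) Phi z <= (size w0)%:R * (b - 2 * g).
  have [n Hn] := long (k1%:R * a - S k1); have [k [nk Sk pk]] := Hp d (k1 + n).+1 d0.
  have [j jn Ek] : exists2 j, (n < j)%N & k = (k1 + j)%N.
    exists (k - k1)%N; first by rewrite ltn_subRL.
    by rewrite subnKC// (leq_trans (leq_addr n k1))// ltnW.
  exists (traject T (iter k1 T x) j); split.
    apply: walk_orbit => //; first exact: leq_ltn_trans jn.
    by rewrite -iterD addnC -Ek metric_sym.
  rewrite sum_traject size_traject -/(S _) -/(S _) -Ek.
  have := Hn j (ltnW jn); move: Sk; rewrite Ek natrD /g; lra.
(* A late enough time absorbs the first [k1] terms and the walk [w] as well. *)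
have [w1 [pw1 w1_avg]] : exists w1, walk T d p w1 p /\
    (size w1)%:R * (b - g) <= \sum_(z <- w1) Phi z.
  pose C := (size w)%:R * b - k1%:R * b + S k1 - \sum_(z <- w) Phi z.
  have [n Hn] := long C; have [k [nk Sk qk]] := Hq d (k1 + n).+1 d0.
  have [j jn Ek] : exists2 j, (n < j)%N & k = (k1 + j)%N.
    exists (k - k1)%N; first by rewrite ltn_subRL.
    by rewrite subnKC// (leq_trans (leq_addr n k1))// ltnW.
  exists (traject T (iter k1 T x) j ++ w); split.
    apply: walk_cat qw; apply: walk_orbit => //; first exact: leq_ltn_trans jn.
    by rewrite -iterD addnC -Ek metric_sym.
  rewrite big_cat/= sum_traject size_cat size_traject -/(S _) -/(S _) -Ek natrD.
  have := Hn j (ltnW jn); move: Sk; rewrite Ek natrD /C.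
  have : 0 <= g * (size w)%:R by rewrite mulr_ge0// ltW.
  lra.
have n0 := walk_size pw0; have n1 := walk_size pw1.
exists (flatten (nseq (size w1) w0)), (flatten (nseq (size w0) w1)).
rewrite !size_flatten_nseq !sum_flatten_nseq; split.
- exact: walk_nseq.
- exact: walk_nseq.
- by rewrite mulnC.
have := ler_wpM2l (ler0n R (size w1)) w0_avg.
have := ler_wpM2l (ler0n R (size w0)) w1_avg.
rewrite natrM; nra.
Qed.

Hypothesis shadow : shadowing_property T.

(** A block consists of a walk from [p] to a separated point, the orbit segment
    of length [n] of that point, a walk back to [p], and [r] copies of one of the
    two loops. Sorting the separated points by the lengths of their walks, which
    are bounded independently of [n], makes all the blocks equally long and
    divides their number by a constant. The loops take a proportion close to
    [theta] of the time: this lowers the rate from [s] to [s'], and it keeps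
    the oscillation, of order [g * theta], above the tracing error [eta]. *)
Lemma htop_irregular_ge_rate x p (g s s' : R) :
  omega_limit T x p -> 0 < g -> 
  (forall d : R, 0 < d -> exists l0 l1 : seq X,
    [/\ walk T d p l0 p, walk T d p l1 p, size l0 = size l1 &
        g * (size l0)%:R <= \sum_(z <- l1) Phi z - \sum_(z <- l0) Phi z]) ->
  0 < s' -> s' < s ->
  (s%:E < htop T [set z | reaches T p z /\ reaches T z p])%E ->
  (s'%:E <= htop T (irregular_set T Phi))%E.
Proof.
move=> xp g0 loops s'0 s's; set Y := [set z | _].
have pp : reaches T p p by exact: (omega_limit_reaches (xp) xp).
have Y0 : Y !=set0 by exists p.
move=> /(htop_gt Y0)[eps0 [n0 [eps00 cost0]]].
have [c c0 Hc] : exists2 c : R, 0 < c & forall n, (n0 <= n)%N ->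
    (c%:E <= bowen_cost T Y s n eps0)%E.
  have [c c0 cn0] : exists2 c : R, 0 < c & (c%:E <= bowen_cost T Y s n0 eps0)%E.
    move: cost0; case: bowen_cost => [c| |] //; first by exists c; rewrite // lee_fin.
    by exists 1; rewrite // leey.
  by exists c => // n n0n; apply: le_trans cn0 _; exact: bowen_cost_homo_n.
(* [theta] is small enough for [s' * (1 + 2 * theta) < s]: the blocks will
   not be longer than [(1 + 2 * theta) * n]. *)
pose theta := Num.min 1 ((s - s') / (4 * s')).
have th0 : 0 < theta by rewrite lt_min ltr01/= divr_gt0//; lra.
have th1 : theta <= 1 by rewrite ge_min lexx.
pose s'' := s' * (1 + 2 * theta).
have s''s : s'' < s.
  have : theta * (4 * s') <= s - s'.
    by rewrite -ler_pdivlMr; [rewrite ge_min lexx orbT|lra].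
  rewrite /s''; lra.
have s''0 : 0 < s'' by rewrite mulr_gt0//; lra.
(* Blocks are shorter than [3 * n] and differ by at least [g * theta * n], so
   that any divisor of [g * theta] above 24 is good. *)
pose eta := g * theta / 25; have eta0 : 0 < eta by rewrite divr_gt0// mulr_gt0.
have [dPhi dPhi0 HPhi] := compact_uniformly_continuous cX cPhi eta0.
pose eps := Num.min dPhi (eps0 / 4).
have eps_gt0 : 0 < eps by rewrite lt_min dPhi0/=; lra.
have eps_le : eps <= eps0 / 4 by rewrite ge_min lexx orbT.
have [delta delta0 Hshadow] := shadow eps_gt0.
pose d := delta / 2; have d0 : 0 < d by rewrite /d; lra.
have d2 : 2 * d = delta by rewrite /d; lra.
have [|M HM] := @uniform_reaches _ _ T Y p d cX d0; first by [].
have Yiter n z : Y z -> Y (iter n T z).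
  move=> [pz zp]; have zz := reaches_trans zp pz.
  split; last exact: reaches_trans (reaches_iter_back cT n zz) zp.
  by case: n => [//|n]; apply: reaches_trans pz _; exact: reaches_iter.
have /choice[pre Hpre] z : exists w, Y z -> (size w <= M)%N /\ walk T d p w z.
  have [/HM[[w wM pw] _]|nY] := pselect (Y z); last by exists [::].
  by exists w.
have /choice[post Hpost] z : exists w, Y z -> (size w <= M)%N /\ walk T d z w p.
  have [/HM[_ [w wM pw]]|nY] := pselect (Y z); last by exists [::].
  by exists w.
have [l0 [l1 [pl0 pl1 l01 gl]]] := loops d d0.
set b0 := size l0 in l01 gl.
have b00 : (0 < b0)%N := walk_size pl0.
pose K := (M.+1 * M.+1)%N.
(* The length [n] of the orbit segments is large enough for all the other
   lengths and constants to be negligible. *)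
have [n [nn0 n1 n_theta nK]] : exists n : nat, [/\ (n0 <= n)%N, (0 < n)%N,
    (2 * M + b0)%:R <= theta * n%:R & (K.+1)%:R <= c * ((s - s'') * n%:R)].
  have cs : 0 < c * (s - s'') by rewrite mulr_gt0// subr_gt0.
  pose x1 := (2 * M + b0)%:R / theta; pose x2 := K.+1%:R / (c * (s - s'')).
  exists (maxn n0.+1 (maxn (Num.trunc x1).+1 (Num.trunc x2).+1)).
  set n := maxn _ _.
  have x1n : x1 <= n%:R.
    by apply: le_trans (ltW (truncnS_gt _)) _; rewrite ler_nat /n !leq_max leqnn ?orbT.
  have x2n : x2 <= n%:R.
    by apply: le_trans (ltW (truncnS_gt _)) _; rewrite ler_nat /n !leq_max leqnn ?orbT.
  split; [by rewrite /n leq_max leqnSn|by rewrite /n leq_max| |].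
    by rewrite mulrC -ler_pdivrMr.
  by rewrite mulrA mulrC -ler_pdivrMr.
have b0R : 0 < b0%:R :> R by rewrite ltr0n.
have [r [r0 r_ge r_le]] : exists r : nat, [/\ (0 < r)%N,
    theta * n%:R <= (r * b0)%:R & (r * b0)%:R <= theta * n%:R + b0%:R].
  exists (Num.trunc (theta * n%:R / b0%:R)).+1; split => //.
    by rewrite natrM -ler_pdivrMr//; exact/ltW/truncnS_gt.
  rewrite mulSn natrD natrM addrC lerD2r -ler_pdivlMr//.
  by rewrite truncn_le divr_ge0 ?ltW// mulr_gt0 ?ltr0n.
(* [N0] is the number of separated points that the cost allows. *)
pose N0 := Num.trunc (c * expR (s * n%:R)).
have [t [tN0 tY [ut st]]] : exists t, [/\ size t = N0, {in t, forall z, Y z} &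
    separated T n eps0 t].
  apply: (many_separated eps00 (Hc n nn0)).
  rewrite expRN ler_pdivrMr ?expR_gt0//.
  by rewrite truncn_le mulr_ge0 ?expR_ge0// ltW.
pose col z : 'I_M.+1 * 'I_M.+1 := (inord (size (pre z)), inord (size (post (iter n T z)))).
have [|[m m'] Hcol] := @pigeonhole_filter _ _ col t.
  by rewrite card_prod card_ord.
rewrite card_prod card_ord -/K tN0 in Hcol.
set t' := [seq z <- t | _] in Hcol.
have t'Y z : z \in t' -> [/\ Y z, size (pre z) = m & size (post (iter n T z)) = m'].
  rewrite mem_filter => /andP[/eqP[Em Em'] /tY Yz].
  have [preM _] := Hpre z Yz; have [postM _] := Hpost _ (Yiter n z Yz).
  by split => //; [rewrite -Em|rewrite -Em']; rewrite inordK.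
pose W (i : 'I_(size t')) (b : bool) :=
  pre (nth p t' i) ++ traject T (nth p t' i) n ++ post (iter n T (nth p t' i)) ++
  flatten (nseq r (if b then l1 else l0)).
pose L := (m + (n + (m' + r * b0)))%N.
have LR : L%:R <= (1 + 2 * theta) * n%:R.
  have mM : (m + m' <= 2 * M)%N by rewrite mul2n -addnn leq_add// -ltnS.
  have : (m + m')%:R + b0%:R <= theta * n%:R.
    by apply: le_trans n_theta; rewrite -natrD ler_nat leq_add2r.
  by rewrite /L !natrD mulrDl mul1r -mulrA; move: r_le; lra.
have expL : expR (s' * L%:R) <= (size t')%:R.
  have KR : 0 < K%:R :> R by rewrite ltr0n.
  have : expR (s' * L%:R) <= expR (s'' * n%:R).
    by rewrite ler_expR /s'' -mulrA ler_wpM2l// ltW.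
  move/le_trans; apply; rewrite -(ler_pM2l KR) -natrM.
  apply: (@le_trans _ _ N0%:R); last by rewrite ler_nat.
  have e1 : 1 <= expR (s'' * n%:R) by rewrite -expR0 ler_expR mulr_ge0// ltW.
  have N0c : c * expR (s * n%:R) < N0%:R + 1 by rewrite natr1; exact: truncnS_gt.
  have es : expR (s * n%:R) = expR (s'' * n%:R) * expR ((s - s'') * n%:R).
    by rewrite -expRD; congr expR; lra.
  have Kc : K%:R + 1 <= c * expR ((s - s'') * n%:R).
    rewrite natr1; apply: le_trans nK _; rewrite ler_pM2l//.
    by apply: le_trans (expR_ge1Dx _); rewrite lerDr.
  have : (K%:R + 1) * expR (s'' * n%:R) <= c * expR (s * n%:R).
    by rewrite es mulrCA mulrC ler_pM2l ?expR_gt0.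
  by move: e1 N0c; rewrite mulrDl mul1r; lra.
have t'0 : (0 < size t')%N.
  by rewrite -(ltr0n R); apply: lt_le_trans expL; exact: expR_gt0.
have tP (i : 'I_(size t')) : nth p t' i \in t' by exact: mem_nth.
apply: (@htop_irregular_ge_blocks _ _ T Phi p (size t') L W d eps0 eps (eps0 / 4)
  eta (r%:R * (\sum_(z <- l1) Phi z - \sum_(z <- l0) Phi z)) s') => //.
- move=> i b; have [_ mi mi'] := t'Y _ (tP i).
  rewrite /W !size_cat mi mi' size_traject size_flatten_nseq.
  by case: b; rewrite -?l01.
- move=> i b; have [Yi _ _] := t'Y _ (tP i); rewrite /W.
  have [_ pi] := Hpre _ Yi; have [_ ip] := Hpost _ (Yiter n _ Yi).
  have seg : walk T d (nth p t' i) (traject T (nth p t' i) n) (iter n T (nth p t' i)).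
    by apply: walk_orbit; rewrite ?mdistxx.
  apply: walk_cat pi _; apply: walk_cat seg _.
  by apply: walk_cat ip _; apply: walk_nseq => //; case: b.
- by rewrite d2; exact: Hshadow.
- by move=> u v uv; apply: HPhi; apply: lt_le_trans uv _; rewrite ge_min lexx.
- move=> i; rewrite /W !big_cat/= !sum_flatten_nseq mulrBr.
  by move: (\sum_(_ <- pre _) _) (\sum_(_ <- traject _ _ _) _) (\sum_(_ <- post _) _) => ? ? ?; lra.
- have : g * (r * b0)%:R <= r%:R * (\sum_(z <- l1) Phi z - \sum_(z <- l0) Phi z).
    by rewrite natrM mulrCA ler_wpM2l.
  apply: lt_le_trans; have : g * (theta * n%:R) <= g * (r * b0)%:R by rewrite ler_pM2l.
  apply: lt_le_trans.
  have L3 : L%:R <= 3 * n%:R :> R.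
    by apply: le_trans LR _; rewrite ler_wpM2r//; lra.
  have := ler_wpM2l (ltW eta0) L3.
  have : 0 < g * theta * n%:R by rewrite mulr_gt0 ?ltr0n// mulr_gt0.
  rewrite /eta; lra.
- move=> i i' ii'; have [Yi mi _] := t'Y _ (tP i); have [Yi' mi' _] := t'Y _ (tP i').
  have nn : nth p t' i != nth p t' i' by rewrite nth_uniq// filter_uniq.
  have it : nth p t' i \in t by have := tP i; rewrite mem_filter => /andP[].
  have it' : nth p t' i' \in t by have := tP i'; rewrite mem_filter => /andP[].
  have := st _ _ it it' nn => /existsNP[j /not_implyP[jn /negP]]; rewrite -leNgt => jsep.
  have seg_nth z : nth p (traject T z n) j = iter j T z.
    by rewrite (set_nth_default z) ?size_traject// nth_traject.
  exists (m + j)%N; first by rewrite /L ltn_add2l ltn_addr.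
  move=> b b'; rewrite /W !nth_cat mi mi' !ltnNge !leq_addr /= !addKn !size_traject.
  by rewrite -!ltnNge jn !seg_nth.
- by lra.
- by lra.
- by lra.
Qed.

(** The points chain equivalent to [p] do not depend on the choice of [p] in the
    omega-limit set, so [p] may be the base point of the two loops. *)
Lemma htop_irregular_ge x p : irregular_set T Phi x -> omega_limit T x p ->
  (htop T [set z | reaches T p z /\ reaches T z p] <= htop T (irregular_set T Phi))%E.
Proof.
move=> ix xp; have [q [g [xq g0 loops]]] := two_loops ix.
have -> : [set z | reaches T p z /\ reaches T z p] = [set z | reaches T q z /\ reaches T z q].
  have pq := omega_limit_reaches xp xq; have qp := omega_limit_reaches xq xp.
  by apply/seteqP; split=> z [? ?]; split; apply: reaches_trans; eassumption.
rewrite leNgt; apply/negP => lt.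
have I0 : irregular_set T Phi !=set0 by exists x.
have I_ge0 := htop_ge0 T I0.
have main := htop_irregular_ge_rate xq g0 loops.
case E : (htop T (irregular_set T Phi)) lt I_ge0 => [h| |] // lt h0;
  last by move: lt; rewrite ltNge leey.
have {}h0 : 0 <= h by rewrite -lee_fin.
have [s hs sY] : exists2 s, h < s & (s%:E < htop T [set z | reaches T q z /\ reaches T z q])%E.
  move: lt; case: htop => [k| |]//; last by move=> _; exists (h + 1); rewrite ?ltry//; lra.
  by rewrite lte_fin => hk; exists ((h + k) / 2); rewrite ?lte_fin; lra.
have hs2 : 0 < (h + s) / 2 by lra.
have s2s : (h + s) / 2 < s by lra.
by have := main s _ hs2 s2s sY; rewrite E lee_fin; lra.
Qed.

End LowerBound.

(** * The entropy of the irregular set *)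

Theorem corollary3p3 (R : realType) (X : metricType R) (T : X -> X)
    (hT : dynamical_system T) (hshadow : shadowing_property T)
    (Phi : X -> R) (hPhi : continuous Phi) :
  htop T (irregular_set T Phi) =
  sup_or0 [set htop T Y | Y in
    [set Y | chain_recurrent_classes T Y /\
             irregular_set T Phi `&` omega_basin T Y !=set0]].
Proof.
have [cX cT] := hT; set I := irregular_set T Phi.
set F := [set Y | _ /\ _].
have class_of_omega x : I x -> exists2 Y, F Y & omega_limit T x `<=` Y.
  move=> Ix; have [p xp] := omega_limit_nonempty T cX x.
  have related u v : omega_limit T x u -> omega_limit T x v -> chain_related T u v.
    move=> xu xv; apply/(chain_relatedE cT).
    by split; [exact: (omega_limit_reaches xu xv)|exact: (omega_limit_reaches xv xu)].
  have xY : omega_limit T x `<=` [set y | CR T y /\ chain_related T p y].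
    by move=> y xy; split; exact: related.
  exists [set y | CR T y /\ chain_related T p y] => //; split; last by exists x.
  by exists p => //; exact: related.
have [I0|/set0P I0] := eqVneq I set0.
  rewrite I0 /htop eqxx /sup_or0 (_ : [set _ | _ in _] = set0) ?eqxx//.
  by apply/seteqP; split=> // t [Y [_ [x [Ix _]]] _]; rewrite -/I I0 in Ix.
have [x0 Ix0] := I0; have [Y0 FY0 xY0] := class_of_omega x0 Ix0.
rewrite /sup_or0 ifN; last by apply/set0P; exists (htop T Y0), Y0.
apply/eqP; rewrite eq_le; apply/andP; split.
  have omega_le x : I x -> (htop T (omega_limit T x) <= ereal_sup (htop T @` F))%E.
    move=> /class_of_omega[Y FY xY].
    apply: (@le_trans _ _ (htop T Y)); last by apply: ereal_sup_ubound; exists Y.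
    by apply: htop_homo => //; exact: omega_limit_nonempty.
  have := omega_le x0 Ix0; have := htop_ge0 T (omega_limit_nonempty T cX x0).
  move=> /le_trans/[apply].
  case: (ereal_sup _) omega_le => [s| |]// omega_le _; last by rewrite leey.
  exact: htop_le_omega_limits.
apply: ge_ereal_sup => _ [_ [[y Cy ->] [x [Ix xY]]] <-].
have [p xp] := omega_limit_nonempty T cX x.
have [_ /(chain_relatedE cT)[yp py]] := xY p xp.
apply: le_trans (htop_irregular_ge cX cT hPhi hshadow Ix xp).
apply: htop_homo; first by exists y; split.
move=> z [_ /(chain_relatedE cT)[yz zy]].
by split; [exact: reaches_trans (py) yz|exact: reaches_trans zy (yp)].
Qed.
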